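(* Let $X$ be a compact Hausdorff space, $\sigma:X\to X$ a continuous map of $X$ onto $X$, and $R:C(X)\to\mathcal{M}(X)$ a positive linear map with $R((f\circ\sigma)g)=f\,R(g)$ for all $f,g\in C(X)$. Let $\lambda\in\mathscr{L}(R)$, and let $W=\frac{d(\lambda\cdot R)}{d\lambda}$, so that $\int_X R(f)\,d\lambda=\int_X fW\,d\lambda$ for all $f\in C(X)$. Let $h\in L^\infty(\lambda)$, $h\geq 0$, satisfy $Rh=h$ and $\int_X h\,d\lambda=1$. Then: (1) For every $x\in X$ there is a unique Borel probability measure $\mathbb{P}_x$ on $Sol_\sigma(X)$ such that for all $n$ and all $f_0,f_1,\dots,f_n\in C(X)$, $$\int_{Z_0^{-1}(x)}(f_0\circ Z_0)(f_1\circ Z_1)\cdots(f_n\circ Z_n)\,d\mathbb{P}_x=f_0(x)\,R\big(f_1R(f_2R(\cdots R(f_nh)\cdots))\big)(x).$$ (2) Moreover, setting $\mathbb{P}=\int_X\mathbb{P}_x\,d\lambda(x)$, $\mathbb{P}$ is a probability measure on $Sol_\sigma(X)$ such that $$\mathbb{E}_{\mathbb{P}}(\,\cdots\mid Z_0=x)=\mathbb{P}_x,$$ where the left-hand side is the conditional measure and the right-hand side is the measure from (1). (3) The following Radon-Nikodym derivative formula holds, as an identity of functions: $$\frac{d\,\mathbb{P}\circ\widetilde\sigma}{d\mathbb{P}}=W\circ Z_0 .$$ Equivalently, setting $U\psi=\big(\sqrt{W\circ Z_0}\big)\,\psi\circ\widetilde\sigma$ for $\psi\in L^2(Sol_\sigma(X),\mathbb{P})$,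 $U$ is a unitary operator in $L^2(Sol_\sigma(X),\mathbb{P})$.
   Context: $\mathcal{M}(X)$ is the space of measurable functions on $X$. Positive means $f\ge0\Rightarrow Rf\ge0$. By Riesz' theorem, for every $x\in X$ there is a Borel measure $P(\cdot\mid x)$ on $X$ with $(Rf)(x)=\int_X f(y)\,P(dy\mid x)$ for $f\in C(X)$; $R$ is extended to measurable functions $F$ by $(RF)(x)=\int_X F(y)\,P(dy\mid x)$, and the extension is again denoted $R$. $\mathscr{L}(R)$ is the set of positive Borel measures $\lambda$ on $X$ such that $R(C(X))\subset L^1(\lambda)$ and $\lambda\cdot R\ll\lambda$, where $\lambda\cdot R$ is the measure $f\mapsto\int_X Rf\,d\lambda$. $\Omega=\prod_0^\infty X$, with coordinate maps $Z_n(x_0,x_1,\dots)=x_n$. The solenoid is $Sol_\sigma(X)=\{(x_n)_0^\infty\in\Omega : \sigma(x_{n+1})=x_n,\ n=0,1,2,\dots\}$ with its relative projective (product) topology; the $Z_n$ are restricted to $Sol_\sigma(X)$. The map $\widetilde\sigma:Sol_\sigma(X)\to Sol_\sigma(X)$, $\widetilde\sigma(x_0,x_1,\dots)=(\sigma(x_0),x_0,x_1,\dots)$, is invertible with inverse $\widetilde\sigma^{-1}(x_0,x_1,x_2,\dots)=(x_1,x_2,\dots)$. $\mathbb{P}\circ\widetilde\sigma$ is the measure $E\mapsto\mathbb{P}(\widetilde\sigma(E))$.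
   Formalization: P_x has total mass h(x), not 1, which the formula forces; the conditional measure given Z_0=x is P_x/h(x); U is an isometry, unitary iff W∘Z_0>0 P-a.e. Measures are regular, P(·|x) is a measurable kernel, Rh=h pointwise, scalars real; mixture and conditioning on Baire events. *)

(* Defs.v *)
From HB Require Import structures.
From mathcomp Require Import all_boot all_order all_algebra.
From mathcomp Require Import all_classical all_reals all_analysis.
From mathcomp Require Import measurable_realfun.

Set Implicit Arguments.
Unset Strict Implicit.
Unset Printing Implicit Defensive.

Import Order.TTheory GRing.Theory Num.Theory.
Import numFieldNormedType.Exports.

Local Open Scope classical_set_scope.
Local Open Scope ring_scope.

Notation borel T := (g_sigma_algebraType (@open T)).

(* Members of the sigma-algebra generated by the continuous real functions.
   On a metrizable space these are exactly the Borel sets. *)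
Definition baire_set (R : realType) (T : topologicalType) : set (set T) :=
  <<s [set A | exists (f : T -> R) (U : set R),
        [/\ continuous f, open U & A = f @^-1` U]] >>.

(* For a finite measure on a compact Hausdorff space this is regularity in the
   sense of the Riesz representation theorem. *)
Definition inner_regular (R : realType) (T : ptopologicalType)
    (mu : {measure set (borel T) -> \bar R}) : Prop :=
  forall A : set (borel T), measurable A ->
    mu A = ereal_sup [set mu K | K in [set K : set T | compact K /\ K `<=` A]].

Definition is_RN_derivative d (T : measurableType d) (R : realType)
    (nu : set T -> \bar R) (mu : {measure set T -> \bar R})
    (w : T -> R) : Prop :=
  [/\ measurable_fun [set: T] w,
      forall x, 0 <= w x
    & forall A, measurable A -> nu A = (\int[mu]_(x in A) (w x)%:E)%E].

Section transfer_operator.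
Variables (R : realType) (X : ptopologicalType).

Definition is_transfer_operator (sigma : X -> X)
    (op : (X -> R) -> (borel X -> R)) : Prop :=
  [/\ forall f : X -> R, continuous f ->
        measurable_fun [set: borel X] (op f),
      forall (a : R) (f g : X -> R), continuous f -> continuous g ->
        op (fun x => a * f x + g x) = (fun x => a * op f x + op g x),
      forall f : X -> R, continuous f ->
        (forall x, 0 <= f x) -> forall x, 0 <= op f x
    & forall f g : X -> R, continuous f -> continuous g ->
        op (fun x => f (sigma x) * g x) = (fun x => f x * op g x)].

(* [P] is the family of Riesz measures of the functionals [op ^~ x]. *)
Definition is_riesz_kernel (op : (X -> R) -> (borel X -> R))
    (P : R.-ker (borel X) ~> (borel X)) : Prop :=
  (forall x, inner_regular (P x)) /\
  forall (f : X -> R) x, continuous f ->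
    (op f x)%:E = (\int[P x]_y (f y)%:E)%E.

Variable P : R.-ker (borel X) ~> (borel X).

(* The extension of the transfer operator to measurable functions. That [P] is a
   kernel, i.e. that [P ^~ A] is measurable for every Borel set [A], says that
   this extension takes values in the measurable functions; it follows from
   [is_riesz_kernel] when [X] is metrizable. *)
Definition ext_op (F : borel X -> \bar R) (x : borel X) : \bar R :=
  (\int[P x]_y F y)%E.

(* [nested_op h [:: f1; ...; fn]] is R (f1 R (f2 ... R (fn h))), with value [h]
   for n = 0. *)
Definition nested_op (h : borel X -> R) (fs : seq (X -> R)) :
    borel X -> \bar R :=
  foldr (fun f F => ext_op (fun y => ((f y)%:E * F y)%E)) (EFin \o h) fs.

(* The measure f |-> \int R f d lam, evaluated on indicator functions. *)
Definition act_measure (lam : {measure set (borel X) -> \bar R})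
    (A : set (borel X)) : \bar R :=
  (\int[lam]_x ext_op (EFin \o \1_A) x)%E.

Definition in_LR (op : (X -> R) -> (borel X -> R))
    (lam : {measure set (borel X) -> \bar R}) : Prop :=
  [/\ inner_regular lam,
      forall f : X -> R, continuous f ->
        lam.-integrable [set: borel X] (EFin \o op f)
    & act_measure lam `<< lam].

End transfer_operator.

Section solenoid.
Variables (X : ptopologicalType) (sigma : {surj [set: X] >-> [set: X]}).

Definition sol_set : set {ptws nat -> X} :=
  [set w | forall n, sigma (w n.+1) = w n].

(* A subtype of the product, with the initial (relative) topology. *)
Definition sol : Type := set_type sol_set.

HB.instance Definition _ := Topological.on sol.

Definition mk_sol (w : {ptws nat -> X}) (w_sol : sol_set w) : sol :=
  exist (fun v => v \in sol_set) w (mem_set w_sol).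

(* [sol] is inhabited because [sigma] is onto. *)
Lemma sol_point_subproof :
  sol_set (fun n => iter n (pinv [set: X] sigma) (point : X)).
Proof. by move=> n; rewrite iterS (surjpK _ (@surj _ _ _ _ sigma))// inE. Qed.

HB.instance Definition _ :=
  isPointed.Build sol (mk_sol sol_point_subproof).

Definition Z (n : nat) (w : sol) : X := \val w n.

Definition shift_seq (w : {ptws nat -> X}) : {ptws nat -> X} :=
  fun n => if n is m.+1 then w m else sigma (w 0%N).

Lemma shift_seq_sol (w : sol) : sol_set (shift_seq (\val w)).
Proof. by case=> [//|n] /=; exact: (set_mem (valP w)). Qed.

Definition sol_shift (w : sol) : sol := mk_sol (shift_seq_sol w).

End solenoid.

Section path_measures.
Variables (R : realType) (X : ptopologicalType).
Variable sigma : {surj [set: X] >-> [set: X]}.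

(* With all the [f i] equal to 1 the formula says that the fibre over [x] has
   mass [h x], so the total mass [h x] says that [Q] is carried by that fibre;
   [Q] is a probability measure exactly when [h x = 1]. *)
Definition is_path_measure (P : R.-ker (borel X) ~> (borel X))
    (h : borel X -> R) (x : X)
    (Q : {measure set (borel (sol sigma)) -> \bar R}) : Prop :=
  [/\ inner_regular Q,
      Q [set: sol sigma] = (h x)%:E
    & forall (n : nat) (f : nat -> X -> R), (forall i, continuous (f i)) ->
        (\int[Q]_(w in Z 0 @^-1` [set x]) (\prod_(i < n.+1) f i (Z i w))%:E =
         (f 0%N x)%:E * nested_op P h [seq f i | i <- iota 1 n] x)%E].

(* [Pm] is \int PP_x d lam(x). For a continuum of open sets the map
   [PP ^~ E] may fail to be measurable when [E] is a Borel set that is not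
   Baire; [Pm] is determined by its values on Baire sets and regularity. *)
Definition is_mixture (lam : {measure set (borel X) -> \bar R})
    (PP : borel X -> {measure set (borel (sol sigma)) -> \bar R})
    (Pm : {measure set (borel (sol sigma)) -> \bar R}) : Prop :=
  inner_regular Pm /\
  forall E : set (sol sigma), baire_set R E ->
    measurable_fun [set: borel X] (PP ^~ E) /\
    Pm E = (\int[lam]_x PP x E)%E.

(* [PP] disintegrates [Pm] along Z_0 with respect to the base measure [lam]. *)
Definition is_disintegration (lam : {measure set (borel X) -> \bar R})
    (PP : borel X -> {measure set (borel (sol sigma)) -> \bar R})
    (Pm : {measure set (borel (sol sigma)) -> \bar R}) : Prop :=
  forall (E : set (sol sigma)) (A : set (borel X)),
    baire_set R E -> measurable A ->
    Pm (E `&` Z 0 @^-1` A) = (\int[lam]_(x in A) PP x E)%E.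

(* [cond x E] is a version of the conditional probability Pm(E | Z_0 = x). *)
Definition is_conditional_measure
    (Pm : {measure set (borel (sol sigma)) -> \bar R})
    (cond : borel X -> set (sol sigma) -> \bar R) : Prop :=
  forall E : set (sol sigma), baire_set R E ->
    measurable_fun [set: borel X] (cond ^~ E) /\
    forall A : set (borel X), measurable A ->
      Pm (E `&` Z 0 @^-1` A) = (\int[Pm]_(w in Z 0 @^-1` A) cond (Z 0 w) E)%E.

Definition shifted_measure (Pm : {measure set (borel (sol sigma)) -> \bar R})
    (E : set (borel (sol sigma))) : \bar R :=
  Pm [set sol_shift w | w in (E : set (sol sigma))].

Definition weighted_shift (W : borel X -> R) (psi : borel (sol sigma) -> R) :
    borel (sol sigma) -> R :=
  fun w => Num.sqrt (W (Z 0 w)) * psi (sol_shift w).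

End path_measures.

(* Operators on L^2 act on representatives; both notions include compatibility
   with almost-everywhere equality. *)
Section L2_operators.
Context d (T : measurableType d) (R : realType).
Variables (mu : {measure set T -> \bar R}) (U : (T -> R) -> (T -> R)).

Local Notation L2 := (Lfun mu 2%:E).

Definition is_L2_isometry : Prop :=
  [/\ forall psi, psi \in L2 -> U psi \in L2,
      forall psi phi, psi \in L2 -> phi \in L2 ->
        psi = phi %[ae mu] -> U psi = U phi %[ae mu],
      forall (a : R) psi phi, psi \in L2 -> phi \in L2 ->
        U (fun x => a * psi x + phi x) = (fun x => a * U psi x + U phi x)
          %[ae mu]
    & forall psi phi, psi \in L2 -> phi \in L2 ->
        (\int[mu]_x (U psi x * U phi x)%:E = \int[mu]_x (psi x * phi x)%:E)%E].

Definition is_L2_unitary : Prop :=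
  is_L2_isometry /\
  forall phi, phi \in L2 -> exists2 psi, psi \in L2 & U psi = phi %[ae mu].

End L2_operators.

(* Main.v *)
From HB Require Import structures.
Require Import Defs.
From mathcomp Require Import all_boot all_order all_algebra.
From mathcomp Require Import all_classical all_reals all_analysis.
From mathcomp Require Import measurable_realfun.

(** A point of the solenoid is determined by any tail of its coordinates, and
    [P x] is carried by the fibre of [sigma] over [x] because
    R((f o sigma) g) = f R(g). Hence every cylinder product (f_0 o Z_0)...(f_n o Z_n)
    is a single function G o Z_n, and R(f_1 R(... R(f_n h))) f_0 = R^n(G h). The
    functional G o Z_n |-> R^n(G h)(x) is well defined since
    R^(n+1)((G o sigma) h) = R^n(G h), by harmonicity of [h]. On a nonmetrizable
    space an iterated kernel need not be a regular measure, so P_x is obtained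
    from this functional by Riesz representation rather than by iterating [P].
    Riesz representation is applied to the lattice of the functions f o Z_n,
    which separates closed sets, without passing to its uniform closure.

    The mixture comes in the same way from G o Z_n |-> int R^n(G h) d lam. The
    disintegration, and the Radon-Nikodym formula for the shift, are equalities
    of regular measures, which need only be checked on functions f o Z_n; they
    pass to Baire sets through the open F_sigma sets, whose indicators are
    increasing limits of functions f o Z_n. *)

Set Implicit Arguments.
Unset Strict Implicit.

Import Order.TTheory GRing.Theory Num.Theory.
Import numFieldNormedType.Exports.

Local Open Scope classical_set_scope.
Local Open Scope ring_scope.

(** * Riesz representation on a compact space *)

(** The function [h] enters in three ways. Its harmonicity makes the functionals at successive
    levels compatible. Its multiples dominate the functions R^n(f h), which keeps them integrable
    although [lam] may be infinite. And h(x) is the mass of P_x, so Z_0 has law h lam under the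
    mixture, and the conditional measure given Z_0 = x is P_x divided by h(x). Regularity is carried
    along throughout because continuous functions do not determine an arbitrary Borel measure on a
    nonmetrizable compact space. The weighted shift preserves inner products because W o Z_0 is the
    density of the shifted measure, but every function in its range vanishes where W o Z_0 does;
    hence it is onto exactly when W o Z_0 is positive almost everywhere. *)

Lemma compact_ind (T : topologicalType) (K : set T) (C : set T -> Prop) :
  compact K -> C set0 ->
  (forall A B, C A -> C B -> C (A `|` B)) ->
  (forall A B, A `<=` B -> C B -> C A) ->
  (forall x, K x -> exists2 B, nbhs x B & C B) -> C K.
Proof.
move=> cK C0 CU Csub Cloc; apply: contrapT => nCK.
(* If [C K] fails, the sets whose complement in [K] satisfies [C] form a proper filter. At a cluster
   point, the local hypothesis puts the complement of a neighbourhood into this filter, a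
   contradiction. *)
pose F : set_system T := [set B | C (K `\` B)].
have FF : ProperFilter F.
  split; first by rewrite /F /= setD0.
  split.
  - by rewrite /F /= setDT.
  - by move=> A B; rewrite /F /= => CA CB; rewrite setDIr; exact: CU.
  - by move=> A B AB; rewrite /F /=; apply: Csub => x [Kx nB]; split => // /AB.
have [|x [Kx clx]] := cK F FF; first by rewrite /F /= setDv.
have [B xB CB] := Cloc x Kx.
have FB : F (~` B) by rewrite /F /= setDE setCK; apply: Csub CB => y [].
by have [y []] := clx _ _ FB xB.
Qed.

Definition vector_lattice (R : realType) (T : Type) (A : set (T -> R)) : Prop :=
  [/\ A (fun=> 1),
      forall (a : R) f g, A f -> A g -> A (fun x => a * f x + g x)
    & forall f g, A f -> A g -> A (fun x => Num.max (f x) (g x))].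

(** Urysohn's lemma with the function taken in [A]; it stands in for density of [A] among the
    continuous functions. *)
Definition separating (R : realType) (T : topologicalType)
    (A : set (T -> R)) : Prop :=
  forall K U, closed K -> open U -> K `<=` U -> exists f,
    [/\ A f, forall x, 0 <= f x <= 1, forall x, K x -> f x = 1
      & forall x, ~ U x -> f x = 0].

Section vector_lattice_theory.
Context {R : realType} {T : Type} {A : set (T -> R)}.
Hypothesis latA : vector_lattice A.

Lemma vlat0 : A (fun=> 0).
Proof.
have [A1 Al _] := latA.
by have := Al (-1) _ _ A1 A1; under eq_fun do rewrite mulr1 addNr.
Qed.

Lemma vlatZ a f : A f -> A (fun x => a * f x).
Proof.
have [_ Al _] := latA; move=> Af.
by have := Al a _ _ Af vlat0; under eq_fun do rewrite addr0.
Qed.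

Lemma vlat_cst a : A (fun=> a).
Proof.
have [A1 Al _] := latA.
by have := vlatZ a A1; under eq_fun do rewrite mulr1.
Qed.

Lemma vlatD f g : A f -> A g -> A (fun x => f x + g x).
Proof.
have [_ Al _] := latA; move=> Af Ag.
by have := Al 1 _ _ Af Ag; under eq_fun do rewrite mul1r.
Qed.

Lemma vlatB f g : A f -> A g -> A (fun x => f x - g x).
Proof.
move=> Af Ag; have := vlatD Af (vlatZ (-1) Ag).
by under eq_fun do rewrite mulN1r.
Qed.

Lemma vlat_max f g : A f -> A g -> A (fun x => Num.max (f x) (g x)).
Proof. by have [_ _] := latA; exact. Qed.

Lemma vlat_min f g : A f -> A g -> A (fun x => Num.min (f x) (g x)).
Proof.
move=> Af Ag; have := vlatB (vlatD Af Ag) (vlat_max Af Ag).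
by under eq_fun do rewrite -[f _ + g _]addr_max_min addrAC subrr add0r.
Qed.

Lemma vlat_sum (g : nat -> T -> R) N : (forall i, A (g i)) ->
  A (fun x => \sum_(i < N) g i x).
Proof.
move=> Ag; elim: N => [|N IH].
  by under eq_fun do rewrite big_ord0; exact: vlat0.
by under eq_fun do rewrite big_ord_recr; exact: vlatD.
Qed.

End vector_lattice_theory.

Section positive_functional.
Context {R : realType} {T : Type} {A : set (T -> R)} {L : (T -> R) -> R}.
Hypothesis latA : vector_lattice A.
Hypothesis L_lin : forall (a : R) f g, A f -> A g ->
  L (fun x => a * f x + g x) = a * L f + L g.
Hypothesis L_pos : forall f, A f -> (forall x, 0 <= f x) -> 0 <= L f.

Lemma fnl0 : L (fun=> 0) = 0.
Proof.
have A0 := vlat0 latA; have := L_lin (-1) A0 A0.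
by under eq_fun do rewrite mulr0 addr0; rewrite mulN1r addNr.
Qed.

Lemma fnlZ a f : A f -> L (fun x => a * f x) = a * L f.
Proof.
move=> Af; have := L_lin a Af (vlat0 latA).
by under eq_fun do rewrite addr0; rewrite fnl0 addr0.
Qed.

Lemma fnl_cst a : L (fun=> a) = a * L (fun=> 1).
Proof.
rewrite -fnlZ; last by case: latA.
by congr L; apply/funext => x; rewrite mulr1.
Qed.

Lemma fnlD f g : A f -> A g -> L (fun x => f x + g x) = L f + L g.
Proof.
move=> Af Ag; have := L_lin 1 Af Ag.
by under eq_fun do rewrite mul1r; rewrite mul1r.
Qed.

Lemma fnlB f g : A f -> A g -> L (fun x => f x - g x) = L f - L g.
Proof.
move=> Af Ag; have := fnlD Af (vlatZ latA (-1) Ag).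
by rewrite fnlZ// mulN1r => <-; congr L; apply/funext => x; rewrite mulN1r.
Qed.

Lemma le_fnl f g : A f -> A g -> (forall x, f x <= g x) -> L f <= L g.
Proof.
move=> Af Ag fg; rewrite -subr_ge0 -fnlB//; apply: L_pos; first exact: vlatB.
by move=> x; rewrite subr_ge0.
Qed.

Lemma fnl_sum (g : nat -> T -> R) N : (forall i, A (g i)) ->
  L (fun x => \sum_(i < N) g i x) = \sum_(i < N) L (g i).
Proof.
move=> Ag; elim: N => [|N IH].
  rewrite big_ord0; under eq_fun do rewrite big_ord0.
  exact: fnl0.
under eq_fun do rewrite big_ord_recr.
by rewrite big_ord_recr/= -IH fnlD//; exact: (vlat_sum latA).
Qed.

End positive_functional.

Section borel_sets.
Context {T : ptopologicalType}.

Lemma open_borel (U : set T) : open U -> measurable (U : set (borel T)).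
Proof. by move=> oU; exact: sub_sigma_algebra. Qed.

Lemma closed_borel (C : set T) : closed C -> measurable (C : set (borel T)).
Proof.
by move=> cC; rewrite -[C]setCK; apply: measurableC; apply: open_borel; exact: closed_openC.
Qed.

Lemma compact_borel (K : set T) : hausdorff_space T -> compact K ->
  measurable (K : set (borel T)).
Proof. by move=> hT cK; apply: closed_borel; exact: compact_closed. Qed.

Lemma continuous_borel (R : realType) (f : T -> R) : continuous f ->
  measurable_fun [set: borel T] f.
Proof.
move=> /continuousP cf; apply: (measurability _ (RGenOpens.measurableE R)).
move=> _ [_ [a [b ->] <-]]; rewrite setTI; apply: open_borel.
exact/cf/interval_open.
Qed.

Lemma continuous_borel_fun (T' : ptopologicalType) (f : T -> T') :
  continuous f -> measurable_fun [set: borel T] (f : borel T -> borel T').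
Proof.
move=> /continuousP cf; apply: (measurability (@open T' : set (set (borel T')))) => // _ [U oU <-].
by rewrite setTI; apply: open_borel; exact: cf.
Qed.

Lemma compact_bounded_fun (R : realType) (f : T -> R) : compact [set: T] ->
  continuous f -> exists2 M, 0 < M & forall x, `|f x| <= M.
Proof.
move=> cT cf.
have [M M0 fM] : exists2 M, 0 < M & forall x, [set: T] x -> `|f x| <= M; last first.
  by exists M => // x; exact: fM.
apply: (compact_ind (C := fun B => exists2 M, 0 < M & forall x, B x -> `|f x| <= M)
  cT).
- by exists 1.
- move=> A B [M M0 AM] [N N0 BN]; exists (Num.max M N); first by rewrite lt_max M0.
  by move=> x [/AM|/BN] fx; rewrite le_max fx ?orbT.
- by move=> A B AB [M M0 BM]; exists M => // x /AB; exact: BM.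
- move=> x _; exists [set y | `|f x - f y| < 1].
    by have := cf x; move=> /cvgrPdist_lt/(_ 1 ltr01).
  exists (`|f x| + 1); first by rewrite ltr_wpDl.
  move=> y /= fxy; rewrite -[f y](subrK (f x)) (le_trans (ler_normD _ _))//.
  by rewrite addrC lerD2l distrC ltW.
Qed.

Lemma continuous_integrable (R : realType)
    (mu : {measure set (borel T) -> \bar R}) (f : T -> R) :
  compact [set: T] -> (mu setT < +oo)%E -> continuous f ->
  mu.-integrable setT (EFin \o f).
Proof.
move=> cT muoo cf; apply: measurable_bounded_integrable => //.
  exact: continuous_borel.
have [M M0 fM] := compact_bounded_fun cT cf.
exists M; split => [|x Mx y _ /=]; first exact: num_real.
exact: le_trans (fM y) (ltW Mx).
Qed.

End borel_sets.

(** * The regular measure of a positive functional *)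

Section riesz_outer_measure.
Context {R : realType} {T : ptopologicalType}.
Variables (A : set (T -> R)) (L : (T -> R) -> R).

(** Functions vanish off [U] instead of having support inside [U], so that [A] need not supply such
    supports; lowering a function by a small level recovers a closed set inside [U]. *)
Definition below (U : set T) : set (T -> R) :=
  [set f | [/\ A f, forall x, 0 <= f x <= 1 & forall x, ~ U x -> f x = 0]].

Definition riesz_open (U : set T) : \bar R :=
  ereal_sup [set (L f)%:E | f in below U].

Definition riesz_outer (E : set T) : \bar R :=
  ereal_inf [set riesz_open U | U in [set U | open U /\ E `<=` U]].

Hypothesis compactT : compact [set: T].
Hypothesis hausdorffT : hausdorff_space T.
Hypothesis latA : vector_lattice A.
Hypothesis contA : forall f, A f -> continuous f.
Hypothesis sepA : separating A.
Hypothesis L_lin : forall (a : R) f g, A f -> A g ->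
  L (fun x => a * f x + g x) = a * L f + L g.
Hypothesis L_pos : forall f, A f -> (forall x, 0 <= f x) -> 0 <= L f.

Let LD := fnlD L_lin.
Let L_le := le_fnl latA L_lin L_pos.
Let Lcst := fnl_cst latA L_lin.

Lemma fnl1_ge0 : 0 <= L (fun=> 1).
Proof. by apply: L_pos => //; case: latA. Qed.

Lemma below0 U : below U (fun=> 0).
Proof. by split => [|x|//]; [exact: vlat0|rewrite lexx ler01]. Qed.

Lemma below_max U f g : below U f -> below U g ->
  below U (fun x => Num.max (f x) (g x)).
Proof.
move=> [Af f01 fU] [Ag g01 gU]; split => [|x|x Ux]; first exact: vlat_max.
- by rewrite le_max ge_max; case/andP: (f01 x) => -> ->; case/andP: (g01 x) => _ ->.
- by rewrite fU// gU// maxxx.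
Qed.

Lemma fnl_below U f : below U f -> 0 <= L f <= L (fun=> 1).
Proof.
move=> [Af f01 _]; rewrite L_pos//=; last by move=> x; case/andP: (f01 x).
by apply: L_le => // [|x]; [case: latA|case/andP: (f01 x)].
Qed.

Lemma riesz_open_ge U f : below U f -> ((L f)%:E <= riesz_open U)%E.
Proof. by move=> Uf; apply: ereal_sup_ubound; exists f. Qed.

Lemma le_riesz_open U V : U `<=` V -> (riesz_open U <= riesz_open V)%E.
Proof.
move=> UV; apply: ge_ereal_sup => _ [f [Af f01 fU] <-].
by apply: riesz_open_ge; split => // x nVx; apply: fU => /UV.
Qed.

Lemma riesz_open_ge0 U : (0 <= riesz_open U)%E.
Proof.
apply: le_trans (riesz_open_ge (below0 U)).
by rewrite lee_fin (fnl0 latA L_lin).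
Qed.

Lemma riesz_open_le U : (riesz_open U <= (L (fun=> 1))%:E)%E.
Proof.
apply: ge_ereal_sup => _ [f Uf <-]; rewrite lee_fin.
by case/andP: (fnl_below Uf).
Qed.

Lemma riesz_open_set0 : riesz_open set0 = 0%E.
Proof.
apply/eqP; rewrite eq_le riesz_open_ge0 andbT.
apply: ge_ereal_sup => _ [f [_ _ f0] <-].
by rewrite (_ : f = fun=> 0) ?(fnl0 latA L_lin)//; apply/funext => x; exact: f0.
Qed.

Let closed1 (x : T) : closed [set x].
Proof. exact: compact_closed (@compact_set1 _ x). Qed.

(* The level [e] is cut off: the truncation vanishes off the compact set
   [f >= e], while [L] decreases by at most [e * L 1]. *)
Definition cutoff (e : R) (f : T -> R) : T -> R := fun x => Num.max (f x - e) 0.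

Lemma vlat_cutoff e f : A f -> A (cutoff e f).
Proof.
move=> Af; apply: vlat_max => //; last exact: vlat0.
by apply: vlatB => //; exact: vlat_cst.
Qed.

Lemma fnl_cutoff e f : A f -> L f <= L (cutoff e f) + e * L (fun=> 1).
Proof.
move=> Af; rewrite -Lcst -LD; [|exact: vlat_cutoff|exact: vlat_cst].
apply: L_le => // [|x]; last by rewrite /cutoff -lerBlDr le_max lexx.
by apply: vlatD; [|exact: vlat_cutoff|exact: vlat_cst].
Qed.

Lemma closed_superlevel (e : R) f : A f -> closed [set x | e <= f x].
Proof.
move=> Af; rewrite (_ : mkset _ = f @^-1` [set y | e <= y])//.
by apply: closed_comp => [x _|]; [exact: contA|exact: closed_ge].
Qed.

Lemma open_superlevel (e : R) f : A f -> open [set x | e < f x].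
Proof.
move=> Af; rewrite (_ : mkset _ = f @^-1` [set y | e < y])//.
by apply: open_comp => [x _|]; [exact: contA|exact: open_gt].
Qed.

(** No partition of unity is used: compactness gives finitely many functions g_i subordinate to the
    U_i with f - e' <= sum g_i. The loss e' handles the points outside the union, where f vanishes
    and no g_i helps. *)
Lemma riesz_open_bigcup (U : (set T)^nat) : (forall n, open (U n)) ->
  (riesz_open (\bigcup_n U n) <= \sum_(n <oo) riesz_open (U n))%E.
Proof.
move=> oU; apply: ge_ereal_sup => _ [f [Af f01 fU] <-].
apply/lee_addgt0Pr => e e0.
(* Chosen so that e' L(1) <= e; the added 1 keeps the denominator positive when L(1) = 0. *)
pose e' := e / (L (fun=> 1) + 1).
have L1 : 0 < L (fun=> 1) + 1 by rewrite ltr_wpDl ?fnl1_ge0.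
have e'0 : 0 < e' by rewrite divr_gt0.
pose C (B : set T) := exists N (g : nat -> T -> R),
  (forall i, below (U i) (g i)) /\
  forall x, B x -> f x - e' <= \sum_(i < N) g i x.
have [N [g [gU fg]]] : C setT.
  apply: (compact_ind compactT).
  - by exists 0%N, (fun=> fun=> 0); split => // i; exact: below0.
  - move=> B1 B2 [N1 [g1 [Ug1 fg1]]] [N2 [g2 [Ug2 fg2]]].
    exists (maxn N1 N2), (fun i x => Num.max (g1 i x) (g2 i x)).
    split => [i|x]; first exact: below_max.
    have sum_le M (g : nat -> T -> R) : (M <= maxn N1 N2)%N ->
        (forall i, g i x <= Num.max (g1 i x) (g2 i x)) ->
        \sum_(i < M) g i x <= \sum_(i < maxn N1 N2) Num.max (g1 i x) (g2 i x).
      move=> MN gg; apply: (@le_trans _ _ (\sum_(i < M) Num.max (g1 i x) (g2 i x))).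
        exact: ler_sum.
      rewrite -!(big_mkord xpredT (fun i => Num.max (g1 i x) (g2 i x))).
      rewrite (big_cat_nat (n := M) _ MN)//= lerDl sumr_ge0// => i _.
      by have [_ /(_ x)/andP[g0 _] _] := below_max (Ug1 i) (Ug2 i).
    move=> [/fg1|/fg2] /le_trans; apply; apply: sum_le => [|i].
    + exact: leq_maxl.
    + by rewrite le_max lexx.
    + exact: leq_maxr.
    + by rewrite le_max lexx orbT.
  - move=> B1 B2 B12 [N [g [Ug fg]]]; exists N, g; split => // x /B12.
    exact: fg.
  (* At a point of some U_i, a function equal to 1 there exceeds f - e' nearby. At a point outside
     the union f = 0, so f - e' is negative nearby and the empty sum suffices. *)
  - move=> x _; have [[i _ Uix]|nUx] := pselect ((\bigcup_n U n) x).
      have [|h [Ah h01 hx hU]] := sepA (@closed1 x) (oU i).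
        by move=> _ ->.
      exists [set y | f y - e' < h y]; last first.
        exists i.+1, (fun j => if j == i then h else fun=> 0).
        split => [j|y /ltW fh].
          by case: eqP => [->|_]; [split|exact: below0].
        rewrite big_ord_recr/= eqxx big1 ?add0r// => j _.
        by rewrite ltn_eqF.
      have Ahf : A (fun y => h y - (f y - e')).
        by apply: vlatB => //; apply: vlatB => //; exact: vlat_cst.
      rewrite (_ : mkset _ = [set y | 0 < h y - (f y - e')]); last first.
        by apply/seteqP; split => y /=; rewrite subr_gt0.
      apply: open_nbhs_nbhs; split; first exact: open_superlevel.
      rewrite /= hx// subr_gt0 ltrBlDr (le_lt_trans (_ : _ <= 1))//.
        by case/andP: (f01 x).
      by rewrite ltrDl.
    exists [set y | 0 < e' - f y].
      apply: open_nbhs_nbhs; split; last by rewrite /= fU// subr0.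
      by apply: open_superlevel; apply: vlatB => //; exact: vlat_cst.
    exists 0%N, (fun=> fun=> 0); split => [j|y /=]; first exact: below0.
    by rewrite big_ord0 subr_gt0 subr_le0 => /ltW.
have LfN : L f <= \sum_(i < N) L (g i) + e.
  have Ag i : A (g i) by case: (gU i).
  rewrite -(fnl_sum latA L_lin)//.
  apply: (@le_trans _ _ (L (fun x => \sum_(i < N) g i x) + e' * L (fun=> 1))).
    rewrite -Lcst -LD; [|exact: (vlat_sum latA)|exact: vlat_cst].
    apply: L_le => // [|x]; last by rewrite -lerBlDr fg.
    by apply: vlatD; [|exact: (vlat_sum latA)|exact: vlat_cst].
  rewrite lerD2l /e' mulrAC ler_pdivrMr// ler_pM2l//.
  by rewrite lerDl.
apply: (@le_trans _ _ ((\sum_(i < N) L (g i))%:E + e%:E)%E); first by rewrite -EFinD lee_fin.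
rewrite leeD2r// -sumEFin; apply: (@le_trans _ _ (\sum_(i < N) riesz_open (U i))%E).
  by apply: lee_sum => i _; exact: riesz_open_ge.
rewrite -(big_mkord xpredT (fun i => riesz_open (U i))).
by apply: nneseries_lim_ge => i _ _; exact: riesz_open_ge0.
Qed.

Lemma riesz_outer_open U : open U -> riesz_outer U = riesz_open U.
Proof.
move=> oU; apply/eqP; rewrite eq_le; apply/andP; split.
  by apply: ereal_inf_lbound; exists U => //; split => // x.
by apply: le_ereal_inf_tmp => _ [V [oV UV] <-]; exact: le_riesz_open.
Qed.

Lemma riesz_outer_ge0 E : (0 <= riesz_outer E)%E.
Proof. by apply: le_ereal_inf_tmp => _ [U _ <-]; exact: riesz_open_ge0. Qed.

Lemma riesz_outer_set0 : riesz_outer set0 = 0%E.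
Proof. by rewrite riesz_outer_open ?riesz_open_set0//; exact: open0. Qed.

Lemma le_riesz_outer E F : E `<=` F -> (riesz_outer E <= riesz_outer F)%E.
Proof.
move=> EF; apply: le_ereal_inf_tmp => _ [U [oU FU] <-].
by apply: ereal_inf_lbound; exists U => //; split => // x /EF /FU.
Qed.

Lemma riesz_outer_setT : riesz_outer setT = (L (fun=> 1))%:E.
Proof.
rewrite riesz_outer_open; last exact: openT.
apply/eqP; rewrite eq_le riesz_open_le/=.
apply: riesz_open_ge; split => [|x|x /(_ I)//]; first by case: latA.
by rewrite ler01 lexx.
Qed.

Lemma riesz_outer_fin E : riesz_outer E \is a fin_num.
Proof.
rewrite ge0_fin_numE ?riesz_outer_ge0//.
by rewrite (le_lt_trans (le_riesz_outer (@subsetT _ E)))// riesz_outer_setT ltry.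
Qed.

Lemma riesz_outer_approx E (e : R) : 0 < e ->
  exists U, [/\ open U, E `<=` U & (riesz_open U <= riesz_outer E + e%:E)%E].
Proof.
move=> e0; have [_ [U [oU EU] <-] /ltW ?] := lb_ereal_inf_adherent e0 (riesz_outer_fin E).
by exists U.
Qed.

Lemma riesz_outer_sigma_subadditive : sigma_subadditive riesz_outer.
Proof.
move=> E; apply/lee_addgt0Pr => e e0.
have /choice[U EU] n : exists U, [/\ open U, E n `<=` U &
    (riesz_open U <= riesz_outer (E n) + (e / (2 ^ n.+1)%:R)%:E)%E].
  by apply: riesz_outer_approx; rewrite divr_gt0// ltr0n expn_gt0.
have oU : open (\bigcup_n U n) by apply: bigcup_open => n _; case: (EU n).
apply: (@le_trans _ _ (riesz_open (\bigcup_n U n))).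
  apply: ereal_inf_lbound; exists (\bigcup_n U n) => //; split => //.
  by apply: subset_bigcup => n _; case: (EU n).
apply: (@le_trans _ _ (\sum_(n <oo) riesz_open (U n))%E).
  by apply: riesz_open_bigcup => n; case: (EU n).
apply: le_trans (epsilon_trick xpredT (fun n => riesz_outer_ge0 (E n)) (ltW e0)).
apply: lee_nneseries => n _; first by move=> _; exact: riesz_open_ge0.
by case: (EU n).
Qed.

Let outer_measure_mixin := isOuterMeasure.Build R T riesz_outer
  riesz_outer_set0 riesz_outer_ge0 le_riesz_outer riesz_outer_sigma_subadditive.
Definition riesz_outer_measure : {outer_measure set T -> \bar R} :=
  HB.pack riesz_outer outer_measure_mixin.

(** Take f subordinate to V [&] U, remove the closed set where f >= d' from V, and take g
    subordinate to what remains, which still contains V minus U. Then g plus the truncation of f at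
    level d' is subordinate to V, since at each point at most one of the two is nonzero. *)
Lemma open_caratheodory U : open U -> riesz_outer_measure.-caratheodory U.
Proof.
move=> oU; apply: le_caratheodory_measurable => E /=.
apply/lee_addgt0Pr => e e0.
have [V [oV EV Ve]] := riesz_outer_approx E e0; apply: le_trans Ve.
have oVU : open (V `&` U) by exact: openI.
apply: (@le_trans _ _ (riesz_open (V `&` U) + riesz_outer (V `&` ~` U))%E).
  apply: leeD; last by apply: le_riesz_outer; exact: setSI.
  by rewrite -(riesz_outer_open oVU); apply: le_riesz_outer; exact: setSI.
rewrite -leeBrDr; last exact: riesz_outer_fin.
apply: ge_ereal_sup => _ [f [Af f01 fU] <-].
rewrite leeBrDr; last exact: riesz_outer_fin.
apply/lee_addgt0Pr => d d0.
pose d' := d / (L (fun=> 1) + 1).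
have L1 : 0 < L (fun=> 1) + 1 by rewrite ltr_wpDl ?fnl1_ge0.
have d'0 : 0 < d' by rewrite divr_gt0.
pose W := V `\` [set x | d' <= f x].
have oW : open W.
  by apply: openI => //; apply: closed_openC; exact: closed_superlevel.
apply: (@le_trans _ _ ((L f)%:E + riesz_open W)%E).
  rewrite leeD2l//; apply: ereal_inf_lbound; exists W => //; split => // x [Vx nUx].
  by split => //=; rewrite fU ?leNgt ?d'0// => -[].
rewrite addeC -leeBrDr//; apply: ge_ereal_sup => _ [g [Ag g01 gW] <-].
rewrite leeBrDr//.
have VUfg : below V (fun x => g x + cutoff d' f x).
  split => [|x|x nVx]; first by apply: vlatD => //; exact: vlat_cutoff.
  - have [fx|fx] := leP d' (f x).
      rewrite gW/=; last by move=> [_ /(_ fx)].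
      rewrite add0r /cutoff le_max lexx orbT/= ge_max ler01 andbT.
      by rewrite lerBlDr ler_wpDr// ?(ltW d'0)//; case/andP: (f01 x).
    by rewrite /cutoff max_r ?addr0// subr_le0 ltW.
  - rewrite gW ?add0r; last by case.
    rewrite /cutoff fU; last by case.
    by rewrite max_r// sub0r oppr_le0 ltW.
apply: (@le_trans _ _ (L (fun x => g x + cutoff d' f x) + d)%:E); last first.
  by rewrite EFinD leeD2r//; exact: riesz_open_ge.
rewrite -EFinD lee_fin LD//; last exact: vlat_cutoff.
rewrite -addrA lerD2l (le_trans (fnl_cutoff d' Af))// lerD2l.
by rewrite /d' mulrAC ler_pdivrMr// ler_pM2l// lerDl.
Qed.

Lemma borel_caratheodory (E : set (borel T)) : measurable E ->
  riesz_outer_measure.-caratheodory E.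
Proof.
move=> mE; pose S := riesz_outer_measure.-cara.-measurable.
suff : <<s @open T >> `<=` S by apply; exact: mE.
apply: smallest_sub; first exact: sigma_algebra_measurable.
exact: open_caratheodory.
Qed.

Lemma riesz_semi_sigma_additive :
  semi_sigma_additive (riesz_outer : set (borel T) -> \bar R).
Proof.
move=> F mF tF mUF.
apply: (@caratheodory_measure_sigma_additive _ _ riesz_outer_measure F) => //.
  by move=> i; exact: borel_caratheodory.
exact: borel_caratheodory.
Qed.

Let measure_mixin := isMeasure.Build _ (borel T) R riesz_outer
  riesz_outer_set0 riesz_outer_ge0 riesz_semi_sigma_additive.
Definition riesz_measure : {measure set (borel T) -> \bar R} :=
  HB.pack (riesz_outer : set (borel T) -> \bar R) measure_mixin.

(** An open set slightly larger than the complement of [E] has a closed, hence compact, complement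
    inside [E]; finiteness of the total mass turns the outer estimate into an inner one. *)
Lemma riesz_inner_regular : inner_regular riesz_measure.
Proof.
move=> E mE; apply/eqP; rewrite eq_le; apply/andP; split; last first.
  by apply: ge_ereal_sup => _ [K [_ KE] <-]; exact: le_riesz_outer.
apply/lee_addgt0Pr => e e0.
have [U [oU EU Ue]] := riesz_outer_approx (~` E) e0.
have cU : closed (~` U) by exact: open_closedC.
apply: (@le_trans _ _ (riesz_outer (~` U) + e%:E)%E); last first.
  rewrite leeD2r//; apply: ereal_sup_ubound; exists (~` U) => //; split.
    exact: subclosed_compact compactT _.
  by move=> x nUx; apply: contrapT => /EU.
have split_T (B : set T) : measurable (B : set (borel T)) ->
    riesz_outer setT = (riesz_outer B + riesz_outer (~` B))%E.
  by move=> /borel_caratheodory/(_ setT); rewrite !setTI.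
have := split_T _ (open_borel oU); rewrite (split_T _ mE) (riesz_outer_open oU).
rewrite -[riesz_measure E]/(riesz_outer E) -(fineK (riesz_outer_fin E)).
rewrite -(fineK (riesz_outer_fin (~` U))).
have fU : riesz_open U \is a fin_num by rewrite -riesz_outer_open ?riesz_outer_fin.
move: Ue; rewrite -(fineK (riesz_outer_fin (~` E))) -(fineK fU) -!EFinD !lee_fin.
move=> UE [EU_]; rewrite -(lerD2r (fine (riesz_outer (~` E)))) EU_.
by rewrite addrC -addrA lerD2l addrC.
Qed.

(** Slice f into layers of height 1. The layer min(f, 1) is subordinate to the set where f > 0, and
    its integral already accounts for the part where f >= 1; the error is the mass of the set where
    0 < f < 1. The errors of different layers live on disjoint sets, so they add up to no more than
    one mass, whatever [N] is. *)
Lemma le_fnl_integral_trunc N f : A f -> (forall x, 0 <= f x <= N%:R) ->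
  ((L f)%:E <= \int[riesz_measure]_x (f x)%:E +
     riesz_outer [set x | (0 < f x < N%:R)%R])%E.
Proof.
elim: N f => [|N IH] f Af f0N.
  have -> : f = fun=> 0.
    by apply/funext => x; apply/eqP; rewrite eq_le andbC.
  rewrite (fnl0 latA L_lin) adde_ge0 ?riesz_outer_ge0//.
  exact: integral_ge0.
have f0 x : 0 <= f x by case/andP: (f0N x).
pose f1 x := Num.min (f x) 1; pose f2 := cutoff 1 f.
have Af1 : A f1 by apply: vlat_min => //; case: latA.
have Af2 : A f2 by exact: vlat_cutoff.
have fE : f = fun x => f1 x + f2 x.
  by apply/funext => x; rewrite /f1 /f2 /cutoff; case: (leP (f x) 1) => fx;
    [rewrite max_r ?addr0// subr_le0|rewrite max_l ?subr_ge0 ?ltW// addrC subrK].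
have f1_ge0 x : 0 <= f1 x by rewrite /f1 le_min f0 ler01.
have f2_ge0 x : 0 <= f2 x by rewrite /f2 /cutoff le_max lexx orbT.
have m g : A g -> measurable_fun [set: borel T] (fun x => (g x)%:E).
  by move=> Ag; apply/measurable_EFinP; apply: continuous_borel; exact: contA.
have mgt e : measurable ([set x | e < f x] : set (borel T)).
  by apply: open_borel; exact: open_superlevel.
have mge e : measurable ([set x | e <= f x] : set (borel T)).
  by apply: closed_borel; exact: closed_superlevel.
have oS g a b : A g -> open [set x | a < g x < b].
  move=> Ag; have -> : [set x | a < g x < b] =
      [set x | a < g x] `&` [set x | - b < - g x].
    by apply/seteqP; split=> x /=; rewrite ltrN2 => /andP.
  apply: openI; first exact: open_superlevel.
  apply: open_superlevel; have := vlatZ latA (-1) Ag.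
  by under eq_fun do rewrite mulN1r.
have Lf1 : ((L f1)%:E <= \int[riesz_measure]_x (f1 x)%:E +
    riesz_measure [set x | (0 < f x < 1)%R])%E.
  apply: (@le_trans _ _ (riesz_measure [set x | 0 < f x])).
    rewrite /= riesz_outer_open; last exact: open_superlevel.
    apply: riesz_open_ge; split => // x.
      by rewrite /f1 f1_ge0 ge_min lexx orbT.
    by move=> /negP; rewrite -leNgt => fx0; rewrite /f1 min_l ?(le_trans fx0)//;
      apply/eqP; rewrite eq_le fx0 f0.
  rewrite (_ : mkset _ = [set x | 1 <= f x] `|` [set x | 0 < f x < 1]); last first.
    apply/seteqP; split => x /=; first by case: (leP 1 (f x)) => fx fx0; [left|right; apply/andP].
    by move=> [|/andP[]//]; exact: lt_le_trans.
  have mS : measurable ([set x | 0 < f x < 1] : set (borel T)).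
    by apply: open_borel; exact: oS.
  apply: (le_trans (measureU2 riesz_measure (mge 1) mS)).
  rewrite leeD2r//= -[leLHS]/(riesz_measure _) -[X in riesz_measure X]setIT -integral_indic//.
  apply: ge0_le_integral => //; [|exact: m|move=> x _].
    by apply/measurable_EFinP; exact: measurable_indic.
  rewrite lee_fin indicE; case: (boolP (x \in _)) => [|_]; last exact: f1_ge0.
  by rewrite inE /= /f1 => fx; rewrite min_r.
have Lf2 : ((L f2)%:E <= \int[riesz_measure]_x (f2 x)%:E +
    riesz_measure [set x | (1 < f x < N.+1%:R)%R])%E.
  apply: (le_trans (IH f2 Af2 _)) => [x|].
    rewrite f2_ge0 /f2 /cutoff ge_max ler0n andbT lerBlDr.
    by case/andP: (f0N x) => _; rewrite -natr1.
  rewrite leeD2l//=; apply: le_riesz_outer => x /= /andP[].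
  rewrite /f2 /cutoff lt_max ltxx orbF subr_gt0 => -> /=.
  by rewrite gt_max ltrBlDr natr1 => /andP[].
have -> : L f = L f1 + L f2 by rewrite {1}fE LD.
rewrite (_ : \int[_]_x _ = \int[riesz_measure]_x (f1 x)%:E + \int[riesz_measure]_x (f2 x)%:E)%E; last first.
  rewrite -ge0_integralD//; [|by move=> x _; rewrite lee_fin|exact: m
    |by move=> x _; rewrite lee_fin|exact: m].
  by apply: eq_integral => x _; rewrite -EFinD {1}fE.
rewrite EFinD (le_trans (leeD Lf1 Lf2))// addeACA leeD2l//.
have mS a b : measurable ([set x | a < f x < b] : set (borel T)).
  by apply: open_borel; exact: oS.
rewrite -measureU//.
  apply: le_riesz_outer => x [] /= /andP[fx fx']; apply/andP; split => //.
    by rewrite (lt_le_trans fx')// ler1n.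
  by rewrite (lt_trans _ fx).
by apply/seteqP; split => // x [] /= /andP[_ +] /andP[+ _]; case: ltgtP.
Qed.

Let fin_riesz E : riesz_measure E \is a fin_num.
Proof. exact: riesz_outer_fin. Qed.

Lemma integrable_fnl f : A f -> riesz_measure.-integrable setT (EFin \o f).
Proof.
by move=> Af; apply: continuous_integrable => //; [rewrite ltey_eq fin_riesz|exact: contA].
Qed.

Let fin_integral f : A f -> (\int[riesz_measure]_x (f x)%:E)%E \is a fin_num.
Proof. by move=> Af; exact: (integrable_fin_num measurableT (integrable_fnl Af)). Qed.

(* The error in [le_fnl_integral_trunc] is at most the total mass whatever the
   size of [f], so replacing [f] by its multiples makes it negligible. *)
Lemma le_fnl_integral f : A f -> (forall x, 0 <= f x) ->
  L f <= fine (\int[riesz_measure]_x (f x)%:E)%E.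
Proof.
move=> Af f0; have [M M0 fM] := compact_bounded_fun compactT (@contA f Af).
set I := fine _; have IE : (\int[riesz_measure]_x (f x)%:E = I%:E)%E by rewrite fineK// fin_integral.
have key n : n%:R * (L f - I) <= L (fun=> 1).
  have Anf : A (fun x => n%:R * f x) by exact: vlatZ.
  have [N nfN] : exists N : nat, forall x, 0 <= n%:R * f x <= N%:R.
    exists (Num.Def.truncn (n%:R * M)).+1 => x; rewrite mulr_ge0//=.
    apply: (@le_trans _ _ (n%:R * M)); last exact/ltW/truncnS_gt.
    by rewrite ler_wpM2l// (le_trans _ (fM x))// ler_norm.
  have := le_fnl_integral_trunc Anf nfN; rewrite (fnlZ latA L_lin)//.
  under eq_integral do rewrite EFinM.
  rewrite ge0_integralZl_EFin//; last 2 first.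
  - by move=> x _; rewrite lee_fin.
  - by apply/measurable_EFinP; apply: continuous_borel; exact: contA.
  rewrite IE => /le_trans /(_ (leeD2l _ (le_riesz_outer (@subsetT _ _)))).
  by rewrite riesz_outer_setT -EFinM -EFinD lee_fin mulrBr lerBlDr addrC.
rewrite leNgt; apply/negP => IL; have IL0 : 0 < L f - I by rewrite subr_gt0.
have := key (Num.Def.truncn (L (fun=> 1) / (L f - I))).+1.
by apply/negP; rewrite -ltNge -ltr_pdivrMr// truncnS_gt.
Qed.

(** If M bounds |f|, [le_fnl_integral] for M + f and for M - f gives the two inequalities; the
    constants cancel because the total mass is L(1). *)
Lemma integral_riesz f : A f -> (\int[riesz_measure]_x (f x)%:E = (L f)%:E)%E.
Proof.
move=> Af; rewrite -[LHS]fineK ?fin_integral//.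
congr EFin; apply/eqP; rewrite eq_le; apply/andP.
have [M M0 fM] := compact_bounded_fun compactT (@contA f Af).
have fM' x : - M <= f x <= M by rewrite -ler_norml.
have AM : A (fun=> M) by exact: vlat_cst.
have IM g : A g -> fine (\int[riesz_measure]_x (M + g x)%:E)%E =
    L (fun=> M) + fine (\int[riesz_measure]_x (g x)%:E)%E.
  move=> Ag; have -> : (\int[riesz_measure]_x (M + g x)%:E =
      \int[riesz_measure]_x M%:E + \int[riesz_measure]_x (g x)%:E)%E.
    by rewrite -integralD_EFin//; exact: integrable_fnl.
  rewrite fineD; [|exact: fin_integral AM|exact: fin_integral Ag].
  by rewrite integral_cst//= riesz_outer_setT -EFinM/= -Lcst.
split; last first.
  have := @le_fnl_integral (fun x => M + f x) (vlatD latA AM Af).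
  rewrite IM// LD// lerD2l; apply => x.
  by rewrite addrC -lerBlDr sub0r; case/andP: (fM' x).
have ANf : A (fun x => - f x).
  by have := vlatZ latA (-1) Af; under eq_fun do rewrite mulN1r.
have LN : L (fun x => - f x) = - L f.
  have := fnlZ latA L_lin (-1) Af; rewrite mulN1r => <-.
  by congr L; apply/funext => x; rewrite mulN1r.
have := @le_fnl_integral (fun x => M + - f x) (vlatD latA AM ANf).
rewrite IM// LD// LN lerD2l.
under eq_integral do rewrite EFinN.
rewrite integralN; last first.
  exact: (integrable_add_def measurableT (integrable_fnl Af)).
rewrite fineN lerN2; apply => x.
by rewrite subr_ge0; case/andP: (fM' x).
Qed.

End riesz_outer_measure.

Theorem riesz_representation (R : realType) (T : ptopologicalType)
    (A : set (T -> R)) (L : (T -> R) -> R) :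
  compact [set: T] -> hausdorff_space T ->
  vector_lattice A -> (forall f, A f -> continuous f) -> separating A ->
  (forall (a : R) f g, A f -> A g ->
    L (fun x => a * f x + g x) = a * L f + L g) ->
  (forall f, A f -> (forall x, 0 <= f x) -> 0 <= L f) ->
  exists mu : {measure set (borel T) -> \bar R}, inner_regular mu /\
    forall f, A f -> (\int[mu]_x (f x)%:E = (L f)%:E)%E.
Proof.
move=> cT hT latA contA sepA L_lin L_pos.
exists (riesz_measure cT hT latA contA sepA L_lin L_pos); split.
  exact: riesz_inner_regular.
exact: integral_riesz.
Qed.

(** * Densities, image measures and regularity *)

Section ge0_measurable_induction.
Context d (T : measurableType d) (R : realType).
Variable Phi : (T -> \bar R) -> Prop.
Hypothesis Phi_indic : forall A, measurable A -> Phi (fun x => (\1_A x)%:E).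
Hypothesis Phi_lin : forall (a : R) f g, 0 <= a ->
  measurable_fun setT f -> (forall x, 0 <= f x)%E ->
  measurable_fun setT g -> (forall x, 0 <= g x)%E ->
  Phi f -> Phi g -> Phi (fun x => a%:E * f x + g x)%E.
Hypothesis Phi_lim : forall (f : (T -> \bar R)^nat) g,
  (forall n, measurable_fun setT (f n)) -> (forall n x, 0 <= f n x)%E ->
  (forall x, nondecreasing_seq (f ^~ x)) ->
  (forall x, f n x @[n --> \oo] --> g x) ->
  (forall n, Phi (f n)) -> Phi g.
Import HBNNSimple.

Lemma ge0_measurable_ind f : measurable_fun setT f ->
  (forall x, 0 <= f x)%E -> Phi f.
Proof.
move=> mf f0; pose f_ := nnsfun_approx measurableT mf.
apply: (@Phi_lim (fun n x => (f_ n x)%:E)).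
- by move=> n; apply/measurable_EFinP; exact: measurable_funP.
- by move=> n x; rewrite lee_fin.
- by move=> x m n mn; rewrite lee_fin; exact/lefP/nd_nnsfun_approx.
- by move=> x; exact: cvg_nnsfun_approx.
move=> n; have f_0 : forall y, range (f_ n) y -> 0 <= y.
  by move=> _ [x _ <-].
(* The simple function is written as a sum over the list of its values, so that [Phi_lin] applies by
   induction on the list. *)
under eq_fun do rewrite fimfunE fsbig_finite//=.
have : {in finmap.enum_fset (fset_set (range (f_ n))), forall y, 0 <= y}.
  by move=> y; rewrite in_fset_set// inE => /f_0.
elim: (finmap.enum_fset _) => [_|y s IH ys].
  have -> : (fun x : T => (\sum_(i <- [::]) i * \1_(f_ n @^-1` [set i]) x)%:E) =
      fun x => (\1_set0 x)%:E.
    by apply/funext => x; rewrite big_nil indic0.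
  exact: Phi_indic.
have m1 z : measurable_fun setT (fun x => (\1_(f_ n @^-1` [set z]) x)%:E).
  by apply/measurable_EFinP; exact: measurable_indic.
have -> : (fun x : T => (\sum_(i <- y :: s) i * \1_(f_ n @^-1` [set i]) x)%:E) =
    fun x => (y%:E * (\1_(f_ n @^-1` [set y]) x)%:E +
      (\sum_(i <- s) i * \1_(f_ n @^-1` [set i]) x)%:E)%E.
  by apply/funext => x; rewrite big_cons EFinD EFinM.
have s0 : {in s, forall z, 0 <= z}.
  by move=> z zs; apply: ys; rewrite inE zs orbT.
apply: Phi_lin => //.
- by apply: ys; rewrite inE eqxx.
- apply/measurable_EFinP; apply: measurable_sum => z.
  by apply: measurable_funM => //; exact: measurable_indic.
- move=> x; rewrite lee_fin big_seq sumr_ge0// => z zs.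
  by rewrite mulr_ge0// s0.
- by apply: Phi_indic; exact: measurable_funPTI.
- exact: IH.
Qed.

End ge0_measurable_induction.

Section density.
Context d (T : measurableType d) (R : realType).
Variables (mu : {measure set T -> \bar R}) (w : T -> R).
Hypotheses (mw : measurable_fun setT w) (w0 : forall x, 0 <= w x).
Local Open Scope ereal_scope.

Definition density (A : set T) : \bar R := \int[mu]_(x in A) (w x)%:E.

Let mwE : measurable_fun setT (EFin \o w). Proof. exact/measurable_EFinP. Qed.
Let wE0 x : 0 <= (w x)%:E. Proof. by rewrite lee_fin. Qed.

Let density0 : density set0 = 0. Proof. exact: integral_set0. Qed.
Let density_ge0 A : 0 <= density A. Proof. exact: integral_ge0. Qed.
Let density_mixin := isMeasure.Build _ T R density density0 density_ge0
  (semi_sigma_additive_nng_induced mwE wE0).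

Definition density_measure : {measure set T -> \bar R} :=
  HB.pack density density_mixin.

Lemma integral_density f : measurable_fun setT f -> (forall x, 0 <= f x) ->
  \int[density_measure]_x f x = \int[mu]_x (f x * (w x)%:E).
Proof.
apply: (ge0_measurable_ind (Phi := fun f => _ = _)) => [A mA|a {}f g a0 mf f0 mg g0 IHf IHg|{}f g mf f0 ndf fg IH].
- rewrite integral_indic// setIT /= /density integral_mkcond.
  apply: eq_integral => x _; rewrite /patch indicE; case: ifPn => _.
    by rewrite mul1e.
  by rewrite mul0e.
- have mM k : measurable_fun setT k -> measurable_fun setT (fun x => k x * (w x)%:E).
    by move=> mk; exact: emeasurable_funM.
  have aE0 : 0 <= a%:E by rewrite lee_fin.
  rewrite ge0_integralD//; [|by move=> x _; rewrite mule_ge0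
    |by apply: emeasurable_funM].
  rewrite ge0_integralZl_EFin// IHf IHg -ge0_integralZl_EFin//; last 2 first.
  + by move=> x _; rewrite mule_ge0.
  + exact: mM.
  rewrite -ge0_integralD//; last 4 first.
  + by move=> x _; rewrite !mule_ge0.
  + by apply: emeasurable_funM => //; exact: mM.
  + by move=> x _; rewrite mule_ge0.
  + exact: mM.
  apply: eq_integral => x _; rewrite ge0_muleDl ?mule_ge0//.
  by rewrite muleA.
- have fgM x : f n x * (w x)%:E @[n --> \oo] --> g x * (w x)%:E.
    by apply: cvgeZr.
  rewrite -[LHS](_ : \int[density_measure]_x limn (f ^~ x) = _); last first.
    by apply: eq_integral => x _; exact/cvg_lim.
  rewrite -[RHS](_ : \int[mu]_x limn (fun n => f n x * (w x)%:E) = _); last first.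
    by apply: eq_integral => x _; exact/cvg_lim.
  rewrite monotone_convergence//.
  rewrite monotone_convergence//; first by under eq_fun do rewrite IH.
  + by move=> n; exact: emeasurable_funM.
  + by move=> n x _; rewrite mule_ge0.
  + by move=> x _ m n mn; rewrite lee_wpmul2r// ndf.
Qed.

End density.

Section image_measure.
Context d1 d2 (T1 : measurableType d1) (T2 : measurableType d2) (R : realType).
Variables (mu : {measure set T1 -> \bar R}) (f : T1 -> T2).
Hypothesis mf : measurable_fun setT f.
Local Open Scope ereal_scope.

Definition image_measure : {measure set T2 -> \bar R} :=
  measure_function_pushforward__canonical__measure_function_Measure mu mf.

Lemma image_measureE E : image_measure E = mu (f @^-1` E).
Proof. by []. Qed.

Lemma integral_image_measure g : measurable_fun setT g -> (forall x, 0 <= g x) ->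
  \int[image_measure]_y g y = \int[mu]_x g (f x).
Proof.
by move=> mg g0; exact: (ge0_integral_pushforward mf mu measurableT mg (fun y _ => g0 y)).
Qed.

End image_measure.

Section inner_regular_theory.
Context {R : realType} {T : ptopologicalType}.
Hypothesis hausdorffT : hausdorff_space T.
Implicit Types mu nu : {measure set (borel T) -> \bar R}.

Lemma inner_regular_approx mu (E : set (borel T)) (e : R) : inner_regular mu ->
  measurable E -> (mu E < +oo)%E -> 0 < e ->
  exists K : set T, [/\ compact K, K `<=` E & (mu E <= mu K + e%:E)%E].
Proof.
move=> imu mE muE e0; have fE : mu E \is a fin_num by rewrite ge0_fin_numE.
have /(ub_ereal_sup_adherent e0) : ereal_sup [set mu K | K in [set K : set T |
    compact K /\ K `<=` E]] \is a fin_num by rewrite -imu.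
move=> [_ [K [cK KE] <-]]; rewrite -imu// => /ltW muK; exists K; split => //.
by rewrite -leeBlDr.
Qed.

(** Inner regularity applied to the complement of [K]: the complement of a compact set found there
    is the open set sought, as the total mass is finite. *)
Lemma outer_regular_approx mu (K : set T) (e : R) : inner_regular mu ->
  (mu setT < +oo)%E -> compact K -> 0 < e ->
  exists U : set T, [/\ open U, K `<=` U & (mu U <= mu K + e%:E)%E].
Proof.
move=> imu muoo cK e0; have mK := compact_borel hausdorffT cK.
have fin (E : set (borel T)) : measurable E -> (mu E < +oo)%E.
  by move=> mE; rewrite (le_lt_trans _ muoo)// le_measure// inE.
have mKc := measurableC mK.
have [C [cC CK muC]] := inner_regular_approx imu mKc (fin _ mKc) e0.
have mC := compact_borel hausdorffT cC.
exists (~` C); split.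
- by apply: closed_openC; exact: compact_closed.
- by move=> x Kx Cx; exact: (CK x Cx).
have muT (B : set (borel T)) : measurable B -> mu setT = (mu B + mu (~` B))%E.
  by move=> mB; rewrite -(setUCr B) measureU//; [exact: measurableC|exact: setICr].
have /esym := muT _ mK; rewrite (muT _ mC).
have finE (E : set (borel T)) : measurable E -> mu E = (fine (mu E))%:E.
  by move=> mE; rewrite fineK// ge0_fin_numE// fin.
move: muC; rewrite (finE _ mK) (finE _ mKc) (finE _ mC) (finE _ (measurableC mC)).
rewrite -!EFinD !lee_fin.
move=> muC [CK'].
rewrite -(lerD2l (fine (mu C))) -CK' addrCA lerD2l addrC//.
by rewrite addrC.
Qed.

(** Only the density is assumed finite, not [mu]. On the part of [E] where 1/(k+1) < w <= k+1, the
    lower bound makes [mu] finite by Chebyshev's inequality, and the upper bound turns a small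
    remainder for [mu] into a small one for the density. These parts exhaust [E] up to the set where
    w = 0, which has density 0. *)
Lemma inner_regular_density mu (w : T -> R)
    (mw : measurable_fun [set: borel T] w) (w0 : forall x, 0 <= w x) :
  inner_regular mu -> (density mu w setT < +oo)%E ->
  inner_regular (density_measure mu mw w0).
Proof.
move=> imu woo E mE; set nu := density_measure _ _ _.
apply/eqP; rewrite eq_le; apply/andP; split; last first.
  apply: ge_ereal_sup => _ [K [cK KE] <-]; apply: le_measure; rewrite ?inE//.
  exact: compact_borel.
set S := ereal_sup _.
have mwgt a : measurable ([set x | a < w x] : set (borel T)).
  rewrite -[X in measurable X]setTI (_ : mkset _ = w @^-1` `]a, +oo[).
    exact: (mw measurableT).
  by apply/seteqP; split => x /=; rewrite in_itv/= andbT.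
have mwle a : measurable ([set x | w x <= a] : set (borel T)).
  rewrite -[X in measurable X]setTI (_ : mkset _ = w @^-1` `]-oo, a]).
    exact: (mw measurableT).
  by apply/seteqP; split => x /=; rewrite in_itv.
pose E_ k : set (borel T) :=
  E `&` ([set x | k.+1%:R^-1 < w x] `&` [set x | w x <= k.+1%:R]).
have mE_ k : measurable (E_ k) by apply: measurableI => //; exact: measurableI.
have nuE : nu E = nu (\bigcup_k E_ k).
  have -> : \bigcup_k E_ k = E `&` [set x | 0 < w x].
    apply/seteqP; split => [x [k _ [Ex [/= wx _]]]|x [Ex /= wx]].
      by split => //=; rewrite (lt_trans _ wx).
    (* An index with k+1 above both 1/w(x) and w(x). *)
    exists (maxn (Num.Def.truncn (w x)^-1) (Num.Def.truncn (w x))) => //; split => //.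
    have kS m p : (m <= p)%N -> (m.+1%:R <= p.+1%:R :> R) by rewrite ler_nat.
    split => /=.
      rewrite invf_plt ?posrE//.
      by rewrite (lt_le_trans (truncnS_gt _))// kS// leq_maxl.
    by rewrite ltW// (lt_le_trans (truncnS_gt _))// kS// leq_maxr.
  rewrite (measureDI nu mE (mwgt 0)) [X in (X + _ = _)%E](_ : _ = 0%E) ?add0e//.
  rewrite /= /density -[RHS](integral0 mu (E `\` [set x | 0 < w x])).
  apply: eq_integral => x; rewrite inE => -[_ /= /negP]; rewrite -leNgt => wx.
  by congr EFin; apply/eqP; rewrite eq_le wx w0.
have ndE : nondecreasing_seq E_.
  move=> m n mn; apply/subsetPset => x [Ex [/= wx wx']]; split => //.
  have mnS : m.+1%:R <= n.+1%:R :> R by rewrite ler_nat.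
  split => /=; last exact: le_trans wx' mnS.
  by rewrite (le_lt_trans _ wx)// lef_pV2// posrE.
have nuE_cvg : nu (E_ k) @[k --> \oo] --> nu E.
  by rewrite nuE; apply: nondecreasing_cvg_mu => //; exact: bigcup_measurable.
rewrite -(cvg_lim _ nuE_cvg)//; apply: lime_le; first by apply/cvg_ex; exists (nu E).
apply: nearW => k; apply/lee_addgt0Pr => e e0.
have muE : (mu (E_ k) < +oo)%E.
  have : (k.+1%:R^-1%:E * mu (E_ k) < +oo)%E.
    apply: le_lt_trans woo; rewrite -integral_cst// /density.
    apply: (@le_trans _ _ (nu (E_ k))); last first.
      by apply: (le_measure nu); rewrite ?inE.
    apply: ge0_le_integral => //=.
    - by apply/measurable_EFinP; exact: measurable_funTS.
    - by move=> x [_ [/ltW ? _]]; rewrite lee_fin.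
  rewrite !ltey; apply: contra => /eqP ->.
  by rewrite gt0_muley// lte_fin.
have [|K [cK KE muK]] := inner_regular_approx imu (mE_ k) muE (_ : 0 < e / k.+1%:R).
  by rewrite divr_gt0.
have mK := compact_borel hausdorffT cK.
apply: (@le_trans _ _ (nu K + e%:E)%E); last first.
  rewrite leeD2r//; apply: ereal_sup_ubound; exists K => //; split => //.
  by move=> x /KE [].
rewrite (measureDI nu (mE_ k) mK) (setIidr KE) addeC leeD2l//.
apply: (@le_trans _ _ (k.+1%:R%:E * mu (E_ k `\` K))%E).
  rewrite -integral_cst; last exact: measurableD.
  apply: ge0_le_integral => //=.
  - exact: measurableD.
  - by move=> x _; rewrite lee_fin.
  - by apply/measurable_EFinP; exact: measurable_funTS.
  - by move=> x [[_ [_ ?]] _]; rewrite lee_fin.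
have fK : mu K \is a fin_num.
  by rewrite ge0_fin_numE// (le_lt_trans _ muE)// le_measure ?inE.
move: muK; rewrite (measureDI mu (mE_ k) mK) (setIidr KE) addeC leeD2lE//.
move=> muK; apply: le_trans (lee_wpmul2l _ muK) _ => //.
by rewrite -EFinM mulrCA divff ?mulr1.
Qed.

(** For [K] compact in the preimage of [E], the set f(K) is compact, lies in [E], and its preimage
    contains [K]. *)
Lemma inner_regular_image (T1 : ptopologicalType)
    (mu : {measure set (borel T1) -> \bar R}) (f : T1 -> T)
    (mf : measurable_fun [set: borel T1] (f : borel T1 -> borel T)) :
  hausdorff_space T1 -> continuous f -> inner_regular mu ->
  inner_regular (image_measure mu mf).
Proof.
move=> hT1 cf imu E mE; apply/eqP; rewrite eq_le; apply/andP; split; last first.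
  apply: ge_ereal_sup => _ [K [cK KE] <-]; apply: le_measure; rewrite ?inE//.
  exact: compact_borel.
have mfE : measurable (f @^-1` E : set (borel T1)).
  by rewrite -[X in measurable X]setTI; exact: mf.
rewrite image_measureE imu//; apply: ge_ereal_sup => _ [K [cK KE] <-].
have cfK : compact (f @` K).
  by apply: continuous_compact => //; exact: continuous_subspaceT.
apply: (@le_trans _ _ (image_measure mu mf (f @` K))); last first.
  by apply: ereal_sup_ubound; exists (f @` K) => //; split => // _ [x /KE ? <-].
rewrite image_measureE le_measure// ?inE.
- exact: compact_borel.
- by rewrite -[X in measurable X]setTI; apply: mf => //; exact: compact_borel.
- exact: preimage_image.
Qed.

(** Inner regularity reduces the claim to compact sets. For [K] compact and [U] open around it with
    nearly the same second measure, a function of [A] lies between the two indicators, so the first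
    measure of [K] is at most the second measure of [U]; the roles are then exchanged. *)
Lemma inner_regular_unique (A : set (T -> R)) mu nu :
  separating A -> (forall f, A f -> continuous f) ->
  inner_regular mu -> inner_regular nu ->
  (mu setT < +oo)%E -> (nu setT < +oo)%E ->
  (forall f, A f -> (forall x, 0 <= f x) ->
    (\int[mu]_x (f x)%:E = \int[nu]_x (f x)%:E)%E) ->
  forall E : set (borel T), measurable E -> mu E = nu E.
Proof.
move=> sepA contA.
have le_compact m1 m2 (K : set T) : inner_regular m1 -> inner_regular m2 ->
    (m2 setT < +oo)%E ->
    (forall f, A f -> (forall x, 0 <= f x) ->
      (\int[m1]_x (f x)%:E = \int[m2]_x (f x)%:E)%E) ->
    compact K -> (m1 K <= m2 K)%E.
  move=> i1 i2 fin2 m12 cK; apply/lee_addgt0Pr => e e0.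
  have [U [oU KU m2U]] := outer_regular_approx i2 fin2 cK e0.
  apply: le_trans m2U.
  have [f [Af f01 f1 f0]] := sepA K U (compact_closed hausdorffT cK) oU KU.
  have mf : measurable_fun [set: borel T] (fun x => (f x)%:E).
    by apply/measurable_EFinP; apply: continuous_borel; exact: contA.
  have mK := compact_borel hausdorffT cK.
  have mI (B : set (borel T)) : measurable B ->
      measurable_fun [set: borel T] (fun x => (\1_B x : R)%:E).
    by move=> mB; apply/measurable_EFinP; exact: measurable_indic.
  have mU := open_borel oU.
  apply: (@le_trans _ _ (\int[m1]_x (f x)%:E)%E).
    rewrite -[K]setIT -integral_indic//.
    apply: ge0_le_integral => //; first exact: mI.
    move=> x _; rewrite lee_fin indicE.
    case: (boolP (x \in K)) => [|_]; last by case/andP: (f01 x).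
    by rewrite inE => /f1 ->.
  rewrite m12//; last by move=> x; case/andP: (f01 x).
  rewrite -[U]setIT -integral_indic//.
  apply: ge0_le_integral => //; [|exact: mI|].
    by move=> x _; rewrite lee_fin; case/andP: (f01 x).
  move=> x _; rewrite lee_fin indicE.
  case: (boolP (x \in U)) => [_|]; first by case/andP: (f01 x).
  by move/negP; rewrite inE => /f0 ->.
move=> imu inu muoo nuoo munu E mE; rewrite imu// inu//; congr ereal_sup.
have eqK (K : set T) : compact K -> mu K = nu K.
  move=> cK; apply/eqP; rewrite eq_le !le_compact// => f Af f0.
  by rewrite munu.
by apply/seteqP; split => _ [K [cK KE] <-]; exists K => //; rewrite eqK.
Qed.

End inner_regular_theory.

Lemma separating_continuous (R : realType) (T : ptopologicalType) :
  compact [set: T] -> hausdorff_space T ->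
  separating [set f : T -> R | continuous f].
Proof.
move=> cT hT K U cK oU KU.
have /normal_separatorP nT := compact_normal hT cT.
have [|f [cf f01 f0 f1]] := (@uniform_separatorP T R (~` U) K).1 (nT R _ _ (open_closedC oU) cK _).
  by apply/seteqP; split => // x [nUx /KU].
exists f; split => //=.
- by move=> x; have /= := f01 (f x) (ex_intro2 _ _ x I erefl); rewrite in_itv.
- by move=> x Kx; have /= := f1 (f x) (ex_intro2 _ _ x Kx erefl).
- by move=> x Ux; have /= := f0 (f x) (ex_intro2 _ _ x Ux erefl).
Qed.

(** * The solenoid *)

Section solenoid_topology.
Context {X : ptopologicalType}.
Hypotheses (X_compact : compact [set: X]) (X_hausdorff : hausdorff_space X).
Variable sigma : {surj [set: X] >-> [set: X]}.
Hypothesis sigma_cont : continuous sigma.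
Local Notation S := (sol sigma).

Lemma sol_val_continuous : continuous (\val : S -> {ptws nat -> X}).
Proof. exact: initial_continuous. Qed.

Lemma Z_continuous n : continuous (Z n : S -> X).
Proof.
move=> w; apply: (@continuous_comp _ _ _ (\val : S -> {ptws nat -> X}) (proj n)).
  exact: sol_val_continuous.
exact: proj_continuous.
Qed.

Lemma Z_sigma n (w : S) : sigma (Z n.+1 w) = Z n w.
Proof. exact: (set_mem (valP w)). Qed.

Lemma Z_iter n m (w : S) : iter m sigma (Z (n + m) w) = Z n w.
Proof.
elim: m => [|m IH]; first by rewrite addn0.
by rewrite addnS iterSr Z_sigma.
Qed.

Lemma sol_ext (v w : S) : (forall n, Z n v = Z n w) -> v = w.
Proof. by move=> vw; apply: val_inj; apply/funext => n; exact: vw. Qed.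

Lemma Z_shift n (w : S) : Z n.+1 (sol_shift w) = Z n w.
Proof. by []. Qed.

Lemma Z_shift0 (w : S) : Z 0 (sol_shift w) = sigma (Z 0 w).
Proof. by []. Qed.

(** Hence f o Z_n determines f, and sign conditions on f o Z_n can be read on [X]. *)
Lemma Z_surj n x : exists w : S, Z n w = x.
Proof.
have sol0 : sol_set sigma (fun k => iter k (pinv [set: X] sigma) x).
  by move=> k; rewrite iterS (surjpK _ (@surj _ _ _ _ sigma))// inE.
elim: n => [|n [w Zw]]; first by exists (mk_sol sol0).
by exists (sol_shift w); rewrite Z_shift.
Qed.

Lemma sol_hausdorff : hausdorff_space S.
Proof.
move=> p q pq; apply: val_inj.
apply: (@hausdorff_product _ (fun=> X) (fun=> X_hausdorff)) => A B pA qB.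
have [w [Aw Bw]] := pq _ _ (sol_val_continuous pA) (sol_val_continuous qB).
by exists (\val w).
Qed.

Lemma sol_set_closed : closed (sol_set sigma).
Proof.
have -> : sol_set sigma = \bigcap_n [set w : {ptws nat -> X} | sigma (w n.+1) = w n].
  by apply/seteqP; split => [w ww n _|w ww n]; [exact: ww|exact: ww n I].
apply: closed_bigI => n _ w clw.
apply: X_hausdorff => A B wA wB.
have cA : nbhs w [set v : {ptws nat -> X} | A (sigma (v n.+1))].
  apply: (@continuous_comp {ptws nat -> X} _ _ (proj n.+1) sigma w) => //.
    exact: proj_continuous.
  exact: sigma_cont.
have cB : nbhs w [set v : {ptws nat -> X} | B (v n)].
  exact: (@proj_continuous _ (fun=> X) n w).
have [v [vn [Av Bv]]] := clw _ (filterI cA cB).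
by exists (v n); split => //; rewrite -vn.
Qed.

Lemma sol_compact : compact [set: S].
Proof.
have cS : compact (sol_set sigma).
  apply: subclosed_compact sol_set_closed _ (@subsetT _ _).
  have := @tychonoff nat (fun=> X) (fun=> setT) (fun=> X_compact).
  by congr (@compact _ _); apply/seteqP.
(* Compactness of [sol_set] in the product passes to the subtype by pushing the filter forward. *)
move=> F FF _; pose G := (\val : S -> {ptws nat -> X}) @ F.
have [|w [Sw clw]] := cS G _.
  by apply: (@filterE _ F) => v; exact: (set_mem (valP v)).
exists (mk_sol Sw); split => // A B FA [B' [[V oV VB] wB'] B'B].
pose val_sol : S -> {ptws nat -> X} := \val.
have GA : G (val_sol @` A).
  have : F (val_sol @^-1` (val_sol @` A)) by apply: filterS FA => v Av; exists v.
  exact.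
have nV : nbhs w V.
  by apply: open_nbhs_nbhs; split => //; move: wB'; rewrite -VB.
have [_ [[v Av <-] Vv]] := clw _ _ GA nV.
by exists v; split => //; apply: B'B; rewrite -VB.
Qed.

(* Otherwise points [k n] of [K] and [l n] of [L] agreeing up to order [n] would
   accumulate at a common point of [K] and [L]. *)
Lemma sol_disjoint_Z (K L : set S) : compact K -> compact L ->
  K `&` L = set0 -> exists n, (Z n @` K) `&` (Z n @` L) = set0.
Proof.
move=> cK cL KL; apply: contrapT => /forallNP nZ.
have /choice[kl klP] n : exists kl : S * S,
    [/\ K kl.1, L kl.2 & Z n kl.1 = Z n kl.2].
  have /eqP/set0P[x [[k Kk kx] [l Ll lx]]] := nZ n.
  by exists (k, l); split => //=; rewrite kx lx.
have [|[k l] [[/= Kk Ll] clkl]] := compact_setX cK cL (F := kl @ \oo) _.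
  by exists 0%N => // n _; case: (klP n).
suff kl_eq : k = l by have : (K `&` L) k by [split; rewrite // kl_eq]; rewrite KL.
apply: sol_ext => m; apply: X_hausdorff => A B kA lB.
have tail : (kl @ \oo) (kl @` [set n | (m <= n)%N]).
  by exists m => // n /= mn; exists n.
have nAB : nbhs (k, l) ((Z m @^-1` A) `*` (Z m @^-1` B)).
  by exists (Z m @^-1` A, Z m @^-1` B) => //; split; exact: Z_continuous.
have [_ [[n /= mn <-] [/= An Bn]]] := clkl _ _ tail nAB.
exists (Z m (kl n).1); split => //.
have [_ _ Zn] := klP n.
(* For n >= m, coordinate m is the image of coordinate n under an iterate of sigma, so agreement at
   n forces agreement at m. *)
by rewrite -(Z_iter m (n - m)) subnKC// Zn -{2}(subnKC mn) Z_iter.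
Qed.

Variable R : realType.

Definition cylinder_fun : set (S -> R) :=
  [set F | exists n (f : X -> R), continuous f /\ F = f \o Z n].

Lemma cylinder_fun_continuous F : cylinder_fun F -> continuous F.
Proof.
move=> [n [f [cf ->]]] w; apply: continuous_comp; first exact: Z_continuous.
exact: cf.
Qed.

Lemma iter_continuous m : continuous (iter m sigma).
Proof.
elim: m => [|m IH] x; first exact: cvg_id.
by apply: continuous_comp; [exact: IH|exact: sigma_cont].
Qed.

Lemma cylinder_lift n m (f : X -> R) :
  f \o Z n = (f \o iter m sigma) \o (Z (n + m) : S -> X).
Proof. by apply/funext => w /=; rewrite Z_iter. Qed.

Lemma cylinder_fun2 F G : cylinder_fun F -> cylinder_fun G ->
  exists n (f g : X -> R), [/\ continuous f, continuous g,
    F = f \o Z n & G = g \o Z n].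
Proof.
move=> [n [f [cf ->]]] [m [g [cg ->]]].
exists (n + m)%N, (f \o iter m sigma), (g \o iter n sigma); split.
- by move=> x; apply: continuous_comp; [exact: iter_continuous|exact: cf].
- by move=> x; apply: continuous_comp; [exact: iter_continuous|exact: cg].
- exact: cylinder_lift.
- by rewrite addnC; exact: cylinder_lift.
Qed.

Lemma cylinder_vector_lattice : vector_lattice cylinder_fun.
Proof.
split=> [|a F G /cylinder_fun2 /[apply] [[n [f [g [cf cg -> ->]]]]]|
  F G /cylinder_fun2 /[apply] [[n [f [g [cf cg -> ->]]]]]].
- by exists 0%N, (fun=> 1); split => // x; exact: cvg_cst.
- exists n, (fun x => a * f x + g x); split => // x.
  by apply: cvgD; [apply: cvgMr; exact: cf|exact: cg].
- exists n, (fun x => Num.max (f x) (g x)); split => // x.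
  by apply: continuous_max; [exact: cf|exact: cg].
Qed.

(** A closed set and a disjoint closed set already have disjoint closed images under a single [Z n],
    where Urysohn's lemma on [X] applies. *)
Lemma cylinder_separating : separating cylinder_fun.
Proof.
move=> K U cK oU KU.
have comp (C : set S) : closed C -> compact C.
  by move=> cC; exact: subclosed_compact cC sol_compact (@subsetT _ _).
have [|n ZKU] := sol_disjoint_Z (comp _ cK) (comp _ (open_closedC oU)).
  by apply/seteqP; split => // w [/KU].
have cZ (C : set S) : closed C -> closed (Z n @` C).
  move=> cC; apply: compact_closed => //; apply: continuous_compact (comp _ cC).
  by apply: continuous_subspaceT; exact: Z_continuous.
have [|f [cf f01 f1 f0]] := separating_continuous R X_compact X_hausdorff
    (cZ _ cK) (closed_openC (cZ _ (open_closedC oU))).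
  by move=> x Kx Ux; have : ((Z n @` K) `&` (Z n @` (~` U))) x by []; rewrite ZKU.
exists (f \o Z n); split => [|w|w Kw|w Uw] /=.
- by exists n, f.
- exact: f01.
- by apply: f1; exists w.
- by apply: f0; apply; exists w.
Qed.

(** A Kolmogorov extension theorem for the inverse limit of [X] under sigma: positive functionals on
    the levels that are compatible under composition with sigma come from one regular measure. *)
Lemma sol_measure_exists (L : nat -> (X -> R) -> R) :
  (forall n (a : R) (f g : X -> R), continuous f -> continuous g ->
    L n (fun x => a * f x + g x) = a * L n f + L n g) ->
  (forall n (f : X -> R), continuous f -> (forall x, 0 <= f x) -> 0 <= L n f) ->
  (forall n (f : X -> R), continuous f -> L n.+1 (f \o sigma) = L n f) ->
  exists mu : {measure set (borel S) -> \bar R}, inner_regular mu /\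
    forall n (f : X -> R), continuous f -> (\int[mu]_w (f (Z n w))%:E = (L n f)%:E)%E.
Proof.
move=> L_lin L_pos L_sigma.
(* Two representations of a cylinder function are compared at the common level n + m, where they
   coincide because Z_(n+m) is onto. *)
have LZ n m f g : continuous f -> continuous g ->
    f \o (Z n : S -> X) = g \o Z m -> L n f = L m g.
  have L_iter k p f' : continuous f' -> L (p + k)%N (f' \o iter k sigma) = L p f'.
    move=> cf'; elim: k => [|k IH]; first by rewrite addn0.
    have -> : f' \o iter k.+1 sigma = (f' \o iter k sigma) \o sigma.
      by apply/funext => x /=; rewrite -iterS iterSr.
    rewrite addnS L_sigma// => x.
    by apply: continuous_comp; [exact: iter_continuous|exact: cf'].
  move=> cf cg fg; rewrite -(L_iter m n f cf) -(L_iter n m g cg) addnC.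
  congr (L _ _); apply/funext => x; have [w <-] := Z_surj (m + n) x.
  rewrite -[LHS]/((f \o iter m sigma) _) /= Z_iter addnC Z_iter.
  exact: (congr1 (fun F => F w) fg).
(* By [LZ] this set of values has a single element for every cylinder function. *)
pose Lam (F : S -> R) : R := get [set r | exists n f,
  [/\ continuous f, F = f \o Z n & r = L n f]].
have LamE n f : continuous f -> Lam (f \o Z n) = L n f.
  move=> cf; have : exists r, [set r | exists m g, [/\ continuous g,
      f \o (Z n : S -> X) = g \o Z m & r = L m g]] r by exists (L n f), n, f.
  by move=> /getPex [m [g [cg fg Lam_fg]]]; rewrite /Lam Lam_fg; exact/esym/LZ.
have [] := riesz_representation (A := cylinder_fun) (L := Lam)
  sol_compact sol_hausdorff cylinder_vector_lattice cylinder_fun_continuous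
  cylinder_separating.
- move=> a F G cF cG; have [n [f [g [cf cg -> ->]]]] := cylinder_fun2 cF cG.
  rewrite !LamE// -L_lin// -LamE//.
  move=> x; apply: cvgD; [apply: cvgMr; exact: cf|exact: cg].
- move=> _ [n [f [cf ->]]] f0; rewrite LamE//; apply: L_pos => // x.
  by have [w <-] := Z_surj n x; exact: f0.
- move=> mu [imu muE]; exists mu; split => // n f cf.
  by rewrite -LamE// -muE//; exists n, f.
Qed.

End solenoid_topology.

(** * The transfer operator on functions dominated by a harmonic function *)

Section dominated_functions.
Context {R : realType} {X : ptopologicalType}.
Variable h : borel X -> R.
Hypotheses (mh : measurable_fun [set: borel X] h) (h_ge0 : forall x, 0 <= h x).
Implicit Types F G : borel X -> R.

(** Bounds by multiples of [h] replace boundedness: [h] is integrable against every [P x] and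
    against [lam], and harmonicity makes the class stable under the transfer operator. *)
Definition dominated (F : borel X -> R) : Prop :=
  measurable_fun [set: borel X] F /\ exists C, forall x, `|F x| <= C * h x.

Lemma dominated_h : dominated h.
Proof. by split => //; exists 1 => x; rewrite mul1r ger0_norm. Qed.

Lemma dominated_lin (a : R) F G : dominated F -> dominated G ->
  dominated (fun x => a * F x + G x).
Proof.
move=> [mF [C FC]] [mG [D GD]]; split.
  by apply: measurable_funD => //; exact: measurable_funM.
exists (`|a| * C + D) => x; rewrite (le_trans (ler_normD _ _))// mulrDl lerD//.
by rewrite normrM -mulrA ler_wpM2l.
Qed.

Lemma dominatedM F G M : measurable_fun [set: borel X] G ->
  (forall x, `|G x| <= M) -> dominated F -> dominated (fun x => G x * F x).
Proof.
move=> mG GM [mF [C FC]]; split; first exact: measurable_funM.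
exists (M * C) => x; rewrite normrM -mulrA; apply: ler_pM => //.
Qed.

Lemma dominated_integrable (m : {measure set (borel X) -> \bar R}) F :
  (\int[m]_x (h x)%:E < +oo)%E -> dominated F ->
  m.-integrable setT (EFin \o F).
Proof.
move=> hoo [mF [C FC]].
have ih : m.-integrable setT (fun x => C%:E * (h x)%:E)%E.
  apply: integrableZl => //; apply/integrableP; split.
    exact/measurable_EFinP.
  by under eq_integral do rewrite gee0_abs ?lee_fin//.
apply: le_integrable ih => //; first exact/measurable_EFinP.
by move=> x _; rewrite /= lee_fin (le_trans (FC x))// ler_norm.
Qed.

End dominated_functions.

(** By inner regularity it suffices to treat a compact [K] off the fibre. Then u(K) is closed and
    misses x, and a Urysohn function that is 1 on u(K) and 0 at x bounds the mass of [K] by 0. This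
    serves both sigma under [P x] and Z_0 under a path measure. *)
Lemma null_off_fiber (R : realType) (T X : ptopologicalType)
    (m : {measure set (borel T) -> \bar R}) (u : T -> X) (x : X) :
  compact [set: X] -> hausdorff_space X -> hausdorff_space T -> continuous u ->
  inner_regular m ->
  (forall g : X -> R, continuous g -> (forall y, 0 <= g y) -> g x = 0 ->
    (\int[m]_w (g (u w))%:E = 0)%E) ->
  m (~` (u @^-1` [set x])) = 0%E.
Proof.
move=> cX hX hT cu im mg0.
have m1 : measurable (u @^-1` [set x] : set (borel T)).
  apply: closed_borel; apply: closed_comp => [y _|]; first exact: cu.
  exact: compact_closed (@compact_set1 _ x).
apply/eqP; rewrite eq_le measure_ge0 andbT (im _ (measurableC m1)).
apply: ge_ereal_sup => _ [K [cK Kx] <-].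
have cuK : closed (u @` K).
  by apply: compact_closed => //; apply: continuous_compact => //;
    exact: continuous_subspaceT.
have [||g [cg g01 g1 g0]] := separating_continuous R cX hX cuK (_ : open (~` [set x])).
- by apply: closed_openC; exact: compact_closed (@compact_set1 _ x).
- by move=> _ [w Kw <-]; exact: (Kx w Kw).
have gx : g x = 0 by apply: g0; apply.
have gge0 y : 0 <= g y by case/andP: (g01 y).
have mK := compact_borel hT cK.
rewrite -(mg0 g cg gge0 gx) -[K]setIT -integral_indic//.
apply: ge0_le_integral => //.
- by apply/measurable_EFinP; exact: measurable_indic.
- by apply/measurable_EFinP; apply: continuous_borel => w;
    apply: continuous_comp; [exact: cu|exact: cg].
move=> w _; rewrite lee_fin indicE.
case: (boolP (w \in K)) => [|_]; last exact: gge0.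
by rewrite inE => Kw; rewrite g1//; exists w.
Qed.

Section kernel_operator.
Context {R : realType} {X : ptopologicalType}.
Variables (P : R.-ker (borel X) ~> (borel X)) (h : borel X -> R).
Hypotheses (mh : measurable_fun [set: borel X] h) (h_ge0 : forall x, 0 <= h x).
Hypothesis h_harmonic : forall x, ext_op P (EFin \o h) x = (h x)%:E.
Variable sigma : {surj [set: X] >-> [set: X]}.
Hypothesis sigma_cont : continuous sigma.
Hypothesis P_fiber : forall x, P x (~` (sigma @^-1` [set x])) = 0%E.
Hypothesis X_compact : compact [set: X].
Hypothesis X_hausdorff : hausdorff_space X.
Local Notation dom := (dominated h).
Implicit Types (F G : borel X -> R) (f g : X -> R).

(** A real-valued form of [ext_op], suited to iteration; on dominated functions the integral is
    finite, so [fine] loses nothing. *)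
Definition kernel_op (F : borel X -> R) (x : borel X) : R :=
  fine (\int[P x]_y (F y)%:E)%E.

Lemma kernel_integrable x F : dom F -> (P x).-integrable setT (EFin \o F).
Proof.
by apply: dominated_integrable => //; rewrite -[ltLHS]/(ext_op P (EFin \o h) x)
  h_harmonic ltry.
Qed.

Lemma kernel_opE x F : dom F -> (\int[P x]_y (F y)%:E = (kernel_op F x)%:E)%E.
Proof.
by move=> dF; rewrite fineK//; exact: (integrable_fin_num _ (kernel_integrable x dF)).
Qed.

Lemma kernel_op_h : kernel_op h = h.
Proof. by apply/funext => x; rewrite /kernel_op -/(ext_op P (EFin \o h) x) h_harmonic. Qed.

Lemma kernel_op_lin (a : R) F G : dom F -> dom G ->
  kernel_op (fun x => a * F x + G x) =
  (fun x => a * kernel_op F x + kernel_op G x).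
Proof.
move=> dF dG; apply/funext => x; apply: EFin_inj.
rewrite -kernel_opE; last exact: dominated_lin.
have iF := kernel_integrable x dF; have iG := kernel_integrable x dG.
have iaF : (P x).-integrable setT (EFin \o (fun y => a * F y)).
  exact: (integrableZl measurableT a iF).
have -> : (\int[P x]_y (a * F y + G y)%:E =
    \int[P x]_y (a * F y)%:E + \int[P x]_y (G y)%:E)%E.
  by rewrite -integralD_EFin.
under eq_integral do rewrite EFinM.
by rewrite integralZl// !kernel_opE.
Qed.

Lemma kernel_op_ge0 F : (forall x, 0 <= F x) -> forall x, 0 <= kernel_op F x.
Proof. by move=> F0 x; rewrite fine_ge0// integral_ge0// => y _; rewrite lee_fin. Qed.

(** The bound is |R F| <= R|F| <= C R h = C h. Measurability goes through positive and negative
    parts, since kernel integrals are measurable for nonnegative integrands. *)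
Lemma dominated_kernel_op F : dom F -> dom (kernel_op F).
Proof.
move=> dF; have [mF [C FC]] := dF; split.
  apply: (measurableT_comp (fine_measurable measurableT)) => //.
  pose Fp x := Num.max (F x) 0; pose Fn x := Num.max (- F x) 0.
  have -> : (fun x => \int[P x]_y (F y)%:E)%E =
      (fun x => \int[P x]_y ((EFin \o F)^\+ y) - \int[P x]_y ((EFin \o F)^\- y))%E.
    by apply/funext => x; rewrite integralE.
  have mFE : measurable_fun [set: borel X] (EFin \o F) by exact/measurable_EFinP.
  apply: emeasurable_funB; apply: measurable_fun_integral_kernel => //.
  - by move=> U mU; exact: measurable_kernel.
  - exact: measurable_funepos.
  - by move=> U mU; exact: measurable_kernel.
  - exact: measurable_funeneg.
exists C => x; rewrite -lee_fin EFinM -(h_harmonic x).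
rewrite -[leLHS]/(`|(kernel_op F x)%:E|)%E -kernel_opE//.
apply: (le_trans (le_abse_integral _ _ _)) => //; first exact/measurable_EFinP.
(* The constant may be negative, but then 0 <= |F| <= C h forces h = 0 and F = 0. *)
have [C0|C0] := leP 0 C.
  rewrite -ge0_integralZl_EFin//; last 2 first.
  - by move=> y _; rewrite lee_fin.
  - exact/measurable_EFinP.
  apply: ge0_le_integral => //.
  - by apply/measurable_EFinP; exact: measurableT_comp.
  - by apply/measurable_EFinP; exact: measurable_funM.
  - by move=> y _; rewrite -EFinM lee_fin.
have h0 y : h y = 0.
  apply/eqP; rewrite eq_le h_ge0 andbT -(nmulr_rge0 _ C0).
  exact: le_trans (normr_ge0 _) (FC y).
have -> : (EFin \o h) = cst 0%E by apply/funext => y /=; rewrite h0.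
rewrite /ext_op integral0 mule0.
under eq_integral => y _.
  have -> : F y = 0.
    by apply/eqP; rewrite -normr_le0 (le_trans (FC y))// h0 mulr0.
  rewrite abse0; over.
by rewrite integral0.
Qed.

Lemma dominated_cont (f : X -> R) F : continuous f -> dom F ->
  dom (fun x => f x * F x).
Proof.
move=> cf dF; have [M _ fM] := compact_bounded_fun X_compact cf.
by apply: (dominatedM (M := M)) => //; exact: continuous_borel.
Qed.

(** The identity assumed for continuous functions extends to dominated ones because g o sigma equals
    g(x) almost everywhere for [P x]. *)
Lemma kernel_op_pull (g : X -> R) F : continuous g -> dom F ->
  kernel_op (fun y => g (sigma y) * F y) = fun x => g x * kernel_op F x.
Proof.
move=> cg dF; apply/funext => x; apply: EFin_inj.
have cgs : continuous (g \o sigma).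
  by move=> y; apply: continuous_comp; [exact: sigma_cont|exact: cg].
have dgF := dominated_cont cgs dF.
have [mF _] := dF; have [mgF _] := dgF.
rewrite -kernel_opE// EFinM -kernel_opE// -integralZl//; last exact: kernel_integrable.
apply: ae_eq_integral => //.
- exact/measurable_EFinP.
- by apply/measurable_EFinP; exact: measurable_funM.
exists (~` (sigma @^-1` [set x])); split => //.
  apply: measurableC; apply: closed_borel.
  apply: closed_comp => [y _|]; first exact: sigma_cont.
  exact: compact_closed (@compact_set1 _ x).
by move=> y /= nE sy; apply: nE => _; rewrite /= sy EFinM.
Qed.

Lemma dominated_iter n F : dom F -> dom (iter n kernel_op F).
Proof. by move=> dF; elim: n => //= n; exact: dominated_kernel_op. Qed.

Lemma iter_kernel_op_lin n (a : R) F G : dom F -> dom G ->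
  iter n kernel_op (fun x => a * F x + G x) =
  (fun x => a * iter n kernel_op F x + iter n kernel_op G x).
Proof.
move=> dF dG; elim: n => //= n ->.
by rewrite kernel_op_lin//; exact: dominated_iter.
Qed.

Lemma iter_kernel_op_ge0 n F : (forall x, 0 <= F x) ->
  forall x, 0 <= iter n kernel_op F x.
Proof. by move=> F0; elim: n => //= n; exact: kernel_op_ge0. Qed.

Lemma iter_kernel_op_pull n (g : X -> R) F : continuous g -> dom F ->
  iter n kernel_op (fun y => g (iter n sigma y) * F y) =
  fun x => g x * iter n kernel_op F x.
Proof.
elim: n g => [//|n IH] g cg dF.
have cgs : continuous (g \o sigma).
  by move=> y; apply: continuous_comp; [exact: sigma_cont|exact: cg].
by rewrite [LHS]/= (IH _ cgs dF) kernel_op_pull//; exact: dominated_iter.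
Qed.

(* R^n (f h) in the paper's notation. *)
Definition path_op n (f : X -> R) : borel X -> R :=
  iter n kernel_op (fun y => f y * h y).

Lemma dominated_path_op n (f : X -> R) : continuous f -> dom (path_op n f).
Proof.
by move=> cf; apply: dominated_iter; apply: dominated_cont => //; exact: dominated_h.
Qed.

Lemma path_op_lin n (a : R) f g : continuous f -> continuous g ->
  path_op n (fun x => a * f x + g x) =
  fun x => a * path_op n f x + path_op n g x.
Proof.
move=> cf cg; rewrite -iter_kernel_op_lin; last 2 first.
- by apply: dominated_cont => //; exact: dominated_h.
- by apply: dominated_cont => //; exact: dominated_h.
by congr iter; apply/funext => x; rewrite mulrDl mulrA.
Qed.

Lemma path_op_ge0 n f : (forall x, 0 <= f x) -> forall x, 0 <= path_op n f x.
Proof. by move=> f0; apply: iter_kernel_op_ge0 => x; rewrite mulr_ge0. Qed.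

Lemma path_op_sigma n f : continuous f -> path_op n.+1 (f \o sigma) = path_op n f.
Proof.
move=> cf; rewrite /path_op iterSr kernel_op_pull ?kernel_op_h//.
exact: dominated_h.
Qed.

Lemma path_op_pull n (g f : X -> R) : continuous g -> continuous f ->
  path_op n (fun y => g (iter n sigma y) * f y) = fun x => g x * path_op n f x.
Proof.
move=> cg cf; rewrite -iter_kernel_op_pull//; last first.
  by apply: dominated_cont => //; exact: dominated_h.
by congr iter; apply/funext => x; rewrite mulrA.
Qed.

Lemma path_op1 x : path_op 0 (fun=> 1) x = h x.
Proof. exact: mul1r. Qed.

(* [fiber_prod f s] is the product of the [f i o Z i], [i] in [s], read off the
   last coordinate. *)
Fixpoint fiber_prod (f : nat -> X -> R) (s : seq nat) : X -> R :=
  if s is i :: s' then fun y => f i (iter (size s') sigma y) * fiber_prod f s' y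
  else fun=> 1.

Lemma fiber_prod_continuous (f : nat -> X -> R) s : (forall i, continuous (f i)) ->
  continuous (fiber_prod f s).
Proof.
move=> cf; elim: s => [|i s IH] x /=; first exact: cvg_cst.
apply: cvgM; last exact: IH.
by apply: continuous_comp; [exact: iter_continuous|exact: cf].
Qed.

(** A factor standing outside k powers of R moves inside them as its composition with sigma^k, by
    [path_op_pull]; in the end all factors form one function under a single power of R. *)
Lemma nested_opE (f : nat -> X -> R) s x : (forall i, continuous (f i)) ->
  nested_op P h [seq f i | i <- s] x = (path_op (size s) (fiber_prod f s) x)%:E.
Proof.
move=> cf; elim: s x => [|i s IH] x /=; first by rewrite /path_op/= mul1r.
rewrite [LHS]/(ext_op P _ x) /ext_op.
under eq_integral do rewrite IH -EFinM.
rewrite kernel_opE; last by apply: dominated_cont => //;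
  apply: dominated_path_op; exact: fiber_prod_continuous.
congr EFin; rewrite -[RHS]/(kernel_op (path_op (size s)
  (fun y => f i (iter (size s) sigma y) * fiber_prod f s y)) x).
by rewrite path_op_pull//; exact: fiber_prod_continuous.
Qed.

Lemma fiber_prod_iota (f : nat -> X -> R) m k (w : sol sigma) :
  fiber_prod f (iota m.+1 k) (Z (m + k) w) =
  \prod_(j < k) f (m.+1 + j)%N (Z (m.+1 + j) w).
Proof.
elim: k m => [|k IH] m; first by rewrite big_ord0.
rewrite big_ord_recl /= size_iota addn0 -[(m + k.+1)%N]addSnnS Z_iter IH.
by congr (_ * _); apply: eq_bigr => j _; rewrite /bump/= addnA addn1.
Qed.

Definition path_prod (f : nat -> X -> R) n : X -> R :=
  fun y => f 0%N (iter n sigma y) * fiber_prod f (iota 1 n) y.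

Lemma path_prod_continuous (f : nat -> X -> R) n : (forall i, continuous (f i)) ->
  continuous (path_prod f n).
Proof.
move=> cf x; apply: cvgM; last exact: fiber_prod_continuous.
by apply: continuous_comp; [exact: iter_continuous|exact: cf].
Qed.

Lemma path_prodE (f : nat -> X -> R) n (w : sol sigma) :
  \prod_(i < n.+1) f i (Z i w) = path_prod f n (Z n w).
Proof.
rewrite big_ord_recl /path_prod; congr (_ * _).
  by have := Z_iter 0 n w; rewrite add0n => ->.
by have := fiber_prod_iota f 0 n w; rewrite add0n => ->.
Qed.

Lemma nested_op_path (f : nat -> X -> R) n x : (forall i, continuous (f i)) ->
  ((f 0%N x)%:E * nested_op P h [seq f i | i <- iota 1 n] x =
   (path_op n (path_prod f n) x)%:E)%E.
Proof.
move=> cf; rewrite nested_opE// size_iota -EFinM path_op_pull//.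
exact: fiber_prod_continuous.
Qed.

End kernel_operator.

(** * Weighted composition operators *)

Section square_integrable.
Context d (T : measurableType d) (R : realType).
Variable mu : {measure set T -> \bar R}.

Lemma Lfun2P (f : T -> R) : f \in Lfun mu 2%:E <->
  measurable_fun setT f /\ (\int[mu]_x (f x ^+ 2)%:E < +oo)%E.
Proof.
split=> [f2|[mf foo]].
  have := Lfun2_integrable_sqr f2 => /integrableP[_ foo]; split.
    by move: f2; rewrite inE => /andP[]; rewrite inE.
  apply: le_lt_trans foo; under [leRHS]eq_integral do rewrite gee0_abs ?lee_fin ?sqr_ge0//.
  exact: lexx.
apply/andP; split; rewrite inE//= /finite_norm unlock.
apply: poweR_lty; apply: le_lt_trans foo.
under eq_integral => x _.
  rewrite -[X in (X `^ _)%E]/(`|f x|%:E) poweR_EFin powR_mulrn// real_normK ?num_real//.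
  over.
exact: lexx.
Qed.

Lemma Lfun2_measurable (f : T -> R) : f \in Lfun mu 2%:E -> measurable_fun setT f.
Proof. by move=> /Lfun2P[]. Qed.

End square_integrable.

Section weighted_composition.
Context d (T : measurableType d) (R : realType).
Variables (mu : {measure set T -> \bar R}) (w : T -> R) (s t : T -> T).
Hypothesis mu_fin : (mu setT < +oo)%E.
Hypotheses (mw : measurable_fun setT w) (w0 : forall x, 0 <= w x).
Hypotheses (ms : measurable_fun setT s) (mt : measurable_fun setT t).
Hypotheses (sK : cancel s t) (tK : cancel t s).
Hypothesis mu_w : forall A, measurable A ->
  mu (t @^-1` A) = (\int[mu]_(x in A) (w x)%:E)%E.

Let U (psi : T -> R) : T -> R := fun x => Num.sqrt (w x) * psi (s x).
Local Notation L2 := (Lfun mu 2%:E).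

(** The measure w mu is the image of mu under [t], and composing g o s with [t] gives back g. *)
Lemma ge0_integral_weighted (g : T -> \bar R) : measurable_fun setT g ->
  (forall x, 0 <= g x)%E ->
  (\int[mu]_x ((w x)%:E * g (s x)) = \int[mu]_x g x)%E.
Proof.
move=> mg g0; have mgs : measurable_fun setT (g \o s) by exact: measurableT_comp.
under eq_integral do rewrite muleC.
rewrite -(integral_density mu mw w0 mgs (fun x => g0 (s x))).
rewrite (eq_measure_integral (image_measure mu mt)); last first.
  by move=> A mA _; rewrite image_measureE mu_w.
rewrite integral_image_measure//; last by move=> x; exact: g0.
by apply: eq_integral => x _ /=; rewrite tK.
Qed.

Lemma integral_weighted (g : T -> R) : measurable_fun setT g ->
  (\int[mu]_x (w x * g (s x))%:E = \int[mu]_x (g x)%:E)%E.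
Proof.
move=> mg; have mgE : measurable_fun setT (EFin \o g) by exact/measurable_EFinP.
rewrite integralE [RHS]integralE; congr (_ - _)%E.
- have := ge0_integral_weighted (measurable_funepos mgE) (funepos_ge0 _) => <-.
  apply: eq_integral => x _; rewrite !funeposE /= -!EFin_max -EFinM.
  by rewrite maxr_pMr// mulr0.
- have := ge0_integral_weighted (measurable_funeneg mgE) (funeneg_ge0 _) => <-.
  apply: eq_integral => x _; rewrite !funenegE /= -!EFin_max -EFinM.
  by rewrite maxr_pMr// mulr0 mulrN.
Qed.

Let measurable_sqrt_w : measurable_fun setT (fun x => Num.sqrt (w x)).
Proof.
apply: (measurableT_comp _ mw).
by apply: continuous_measurable_fun; exact: sqrt_continuous.
Qed.

Let measurable_U psi : measurable_fun setT psi -> measurable_fun setT (U psi).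
Proof.
by move=> mpsi; apply: measurable_funM => //; exact: measurableT_comp.
Qed.

Lemma weighted_L2 psi : psi \in L2 -> U psi \in L2.
Proof.
move=> /Lfun2P[mpsi psioo]; apply/Lfun2P; split; first exact: measurable_U.
under eq_integral do rewrite exprMn sqr_sqrtr//.
by rewrite (integral_weighted (g := fun x => psi x ^+ 2))//; exact: measurable_funX.
Qed.

(** Composition with [s] alone need not respect null sets. If N is null, the integral of w over the
    preimage of N under [s] is mu(N) = 0, so w vanishes almost everywhere on it and the factor
    sqrt(w) hides the discrepancy. *)
Lemma weighted_ae psi phi : psi = phi %[ae mu] -> U psi = U phi %[ae mu].
Proof.
move=> [N [mN N0 psiN]].
have msN : measurable (s @^-1` N) by rewrite -[X in measurable X]setTI; exact: ms.
have : (\int[mu]_(x in s @^-1` N) `|(w x)%:E| = 0)%E.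
  under eq_integral do rewrite gee0_abs ?lee_fin//.
  rewrite -mu_w// -[RHS]N0; congr (mu _); apply/seteqP.
  by split=> x /=; rewrite tK.
move/ae_eq_integral_abs => /(_ msN).
have mwN : measurable_fun (s @^-1` N) (EFin \o w).
  by apply: measurable_funTS; exact/measurable_EFinP.
move=> /(_ mwN); apply: filterS => x wx _; rewrite /U.
have [sxN|sxN] := pselect (N (s x)).
  by move: (wx sxN) => /= [->]; rewrite sqrtr0 !mul0r.
congr (_ * _); apply: contrapT => neq; apply: sxN; apply: psiN => /= h.
exact/neq/h.
Qed.

Lemma weighted_isometry : is_L2_isometry mu U.
Proof.
split=> [psi|psi phi _ _|a psi phi _ _|psi phi psi2 phi2].
- exact: weighted_L2.
- exact: weighted_ae.
- by apply: aeW => x _; rewrite /U /= mulrDr mulrCA.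
- rewrite -(integral_weighted (g := fun x => psi x * phi x)).
    apply: eq_integral => x _; rewrite /U mulrACA -expr2 sqr_sqrtr//.
  exact: measurable_funM (Lfun2_measurable psi2) (Lfun2_measurable phi2).
Qed.

(** If the constant 1 is in the range, then w cannot vanish on a set of positive measure.
    Conversely, phi is the image of (phi / sqrt(w)) o t. *)
Lemma weighted_unitaryP : is_L2_unitary mu U <-> \forall x \ae mu, 0 < w x.
Proof.
split=> [[_ surjU]|wpos].
  have L1 : (fun=> 1) \in L2.
    apply/Lfun2P; split; first exact: measurable_cst.
    rewrite expr1n; have := integral_cst mu measurableT 1%E.
    by rewrite mul1e => ->.
  have [psi _] := surjU _ L1; apply: filterS => x /(_ I) Ux.
  rewrite lt_neqAle w0 andbT eq_sym; apply/eqP => wx.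
  by move: Ux; rewrite /U wx sqrtr0 mul0r => /esym/eqP; rewrite oner_eq0.
split; first exact: weighted_isometry.
move=> phi /Lfun2P[mphi phioo].
pose v x := w x `^ (- 2^-1).
have mv : measurable_fun setT v by exact: (measurableT_comp (measurable_powR _) mw).
(* Only an inequality, since the left side is 0 where w = 0; it is enough to put the preimage in
   L^2. *)
have wv x : w x * (v x * phi (t (s x))) ^+ 2 <= phi x ^+ 2.
  rewrite sK exprMn mulrA ler_piMl ?sqr_ge0//.
  have [->|wx] := eqVneq (w x) 0; first by rewrite mul0r.
  have wx0 : 0 < w x by rewrite lt_neqAle eq_sym wx w0.
  by rewrite /v powRN powR12_sqrt// exprVn sqr_sqrtr// divff.
pose psi x := v (t x) * phi (t x).
have mpsi : measurable_fun setT psi.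
  by apply: measurable_funM; exact: measurableT_comp.
exists psi.
  apply/Lfun2P; split => //; apply: le_lt_trans phioo.
  rewrite -(integral_weighted (g := fun x => psi x ^+ 2)); last exact: measurable_funX.
  apply: ge0_le_integral => //.
  - by move=> x _; rewrite lee_fin mulr_ge0// sqr_ge0.
  - apply/measurable_EFinP; apply: measurable_funM => //.
    by apply: measurable_funX; exact: (measurableT_comp mpsi).
  - by apply/measurable_EFinP; exact: measurable_funX.
  - by move=> x _; rewrite lee_fin /psi {1}sK; exact: wv.
apply: filterS wpos => x wx _; rewrite /U /psi sK mulrA /v powRN powR12_sqrt//.
by rewrite divff ?mul1r// gt_eqF// sqrtr_gt0.
Qed.

End weighted_composition.

(** * Approximation of open F_sigma sets *)

Section fsigma_open_sets.
Context {T : ptopologicalType}.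

(** On a compact Hausdorff space these are the cozero sets. They are stable under intersection, and
    membership can be approximated from below by functions of any separating lattice. *)
Definition fsigma_open : set (set T) :=
  [set E | open E /\ exists C : (set T)^nat,
    (forall k, closed (C k)) /\ E = \bigcup_k C k].

Lemma fsigma_open_setI : setI_closed fsigma_open.
Proof.
move=> E F [oE [C [cC EC]]] [oF [D [cD FD]]]; split; first exact: openI.
exists (fun k => if unpickle k is Some (i, j) then C i `&` D j else set0).
split=> [k|]; first by case: (unpickle _) => [[i j]|]; [exact: closedI|exact: closed0].
apply/seteqP; split => [x|x [k _]].
  rewrite EC FD => -[[i _ Ci] [j _ Dj]].
  by exists (pickle (i, j)) => //; rewrite pickleK.
by case: (unpickle _) => [[i j]|] // [Ci Dj]; split; [rewrite EC; exists i|rewrite FD; exists j].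
Qed.

Lemma fsigma_openT : fsigma_open setT.
Proof.
split; first exact: openT.
exists (fun=> setT); split => [_|]; first exact: closedT.
by apply/seteqP; split => // x _; exists 0%N.
Qed.

(** The k-th closed set consists of the points at distance at least 1/(k+1) from the complement of
    [U]; its own complement is a union of open balls. *)
Lemma open_real_Fsigma (R : realType) (U : set R) : open U ->
  exists C : (set R)^nat, (forall k, closed (C k)) /\ U = \bigcup_k C k.
Proof.
move=> oU; exists (fun k => [set x | forall y, `|x - y| < k.+1%:R^-1 -> U y]).
split=> [k|]; last first.
  apply/seteqP; split=> [x Ux|x [k _ /(_ x)]]; last by apply; rewrite subrr normr0.
  have /nbhs_ballP[e /= e0 eU] : nbhs x U by exact: open_nbhs_nbhs.
  exists (Num.Def.truncn e^-1) => // y xy; apply: eU; rewrite /ball/=.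
  rewrite (lt_trans xy)// invf_plt ?posrE//.
  exact: truncnS_gt.
rewrite -openC; set C := ~` _.
have -> : C = \bigcup_(y in ~` U) ball y k.+1%:R^-1.
  apply/seteqP; split => [x /= /existsNP[y /not_implyP[xy nUy]]|x [y nUy yx] /=].
    by exists y => //; rewrite /ball/= distrC.
  by move=> /(_ y) xU; apply: nUy; apply: xU; rewrite distrC.
by apply: bigcup_open => y _; exact: ball_open.
Qed.

Lemma baire_fsigma_open (R : realType) (E : set T) :
  baire_set R E -> <<s fsigma_open >> E.
Proof.
apply: sub_smallest2r; first exact: smallest_sigma_algebra.
move=> _ [f [U [cf oU ->]]]; split; first by move/continuousP : cf; exact.
have [C [cC ->]] := open_real_Fsigma oU.
exists (fun k => f @^-1` C k); split => [k|]; last by rewrite preimage_bigcup.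
by apply: closed_comp => // x _; exact: cf.
Qed.

Fixpoint running_max (R : realType) (G : nat -> T -> R) k : T -> R :=
  if k is k'.+1 then fun x => Num.max (running_max G k' x) (G k x) else G 0%N.

(** Choose for each closed piece of [E] a function of [A] that is 1 on the piece and 0 off [E]. The
    running maxima increase, stay 0 off [E], and become 1 at a point of [E] once its piece is
    reached. *)
Lemma fsigma_open_approx (R : realType) (A : set (T -> R)) (E : set T) :
  vector_lattice A -> separating A -> fsigma_open E ->
  exists F : nat -> T -> R, [/\ forall k, A (F k), forall k x, 0 <= F k x,
    forall x, nondecreasing_seq (F ^~ x)
    & forall x, (F k x)%:E @[k --> \oo] --> (\1_E x : R)%:E].
Proof.
move=> latA sepA [oE [C [cC EC]]].
have /choice[G GP] k : exists f, [/\ A f, forall x, 0 <= f x <= 1,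
    forall x, C k x -> f x = 1 & forall x, ~ E x -> f x = 0].
  by apply: sepA => // x Cx; rewrite EC; exists k.
have F01 k x : 0 <= running_max G k x <= 1.
  elim: k => [|k /andP[IH1 IH2]] /=; first by have [_ /(_ x)] := GP 0%N.
  have [_ /(_ x)/andP[G0 G1] _ _] := GP k.+1.
  by rewrite le_max IH1 ge_max IH2 G1.
have ndF x : nondecreasing_seq ((running_max G)^~ x).
  by apply/nondecreasing_seqP => k /=; rewrite le_max lexx.
exists (running_max G); split => // [k|k x|x].
- elim: k => [|k IH] /=; first by case: (GP 0%N).
  by apply: vlat_max => //; case: (GP k.+1).
- by case/andP: (F01 k x).
apply: cvg_EFin; first by apply: nearW.
rewrite indicE; case: (boolP (x \in E)) => [|/negP]; rewrite inE => Ex.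
  have [j _ Cj] : (\bigcup_k C k) x by rewrite -EC.
  apply: cvg_near_cst; exists j => // k /= jk.
  apply/eqP; rewrite eq_le; have /andP[_ ->] := F01 k x.
  apply: le_trans (ndF x _ _ jk).
  have [_ _ /(_ x Cj) Gj _] := GP j.
  by case: j {Cj jk} Gj => [|j] /= ->//; rewrite le_max lexx orbT.
have F0 k : running_max G k x = 0.
  elim: k => [|k IH] /=; first by have [_ _ _ ->] := GP 0%N.
  by rewrite IH; have [_ _ _ ->] := GP k.+1 => //; rewrite maxxx.
by apply: cvg_near_cst; apply: nearW => k /=; rewrite F0.
Qed.

End fsigma_open_sets.

(** * Path measures and their mixture *)

(** R(g o sigma)(x) = g(x) R(1)(x) is 0 whenever g(x) = 0, which is the criterion of
    [null_off_fiber]. *)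
Lemma kernel_fiber (R : realType) (X : ptopologicalType)
    (sigma : {surj [set: X] >-> [set: X]}) (op : (X -> R) -> (borel X -> R))
    (P : R.-ker (borel X) ~> (borel X)) :
  compact [set: X] -> hausdorff_space X -> continuous sigma ->
  is_transfer_operator sigma op -> is_riesz_kernel op P ->
  forall x, P x (~` (sigma @^-1` [set x])) = 0%E.
Proof.
move=> cX hX cs [_ _ _ op_pull] [iP opE] x.
apply: (null_off_fiber (R := R) cX hX hX cs (iP x)) => g cg g0 gx.
have cgs : continuous (g \o sigma).
  by move=> y; apply: continuous_comp; [exact: cs|exact: cg].
have c1 : continuous ((fun=> 1) : X -> R) by move=> y; exact: cvg_cst.
rewrite -[LHS](opE (g \o sigma) x cgs).
have := congr1 (@^~ x) (op_pull g (fun=> 1) cg c1).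
under eq_fun do rewrite mulr1.
by rewrite gx mul0r => ->.
Qed.

Section path_measures.
Context {R : realType} {X : ptopologicalType}.
Hypotheses (X_compact : compact [set: X]) (X_hausdorff : hausdorff_space X).
Variable sigma : {surj [set: X] >-> [set: X]}.
Hypothesis sigma_cont : continuous sigma.
Variables (P : R.-ker (borel X) ~> (borel X)) (h : borel X -> R).
Hypotheses (mh : measurable_fun [set: borel X] h) (h_ge0 : forall x, 0 <= h x).
Hypothesis h_harmonic : forall x, ext_op P (EFin \o h) x = (h x)%:E.
Hypothesis P_fiber : forall x, P x (~` (sigma @^-1` [set x])) = 0%E.
Local Notation S := (sol sigma).
Local Notation L := (path_op P h).

Let S_compact : compact [set: S] := sol_compact X_compact X_hausdorff sigma_cont.
Let S_hausdorff : hausdorff_space S := sol_hausdorff X_hausdorff (sigma := sigma).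
Let dominated_L := dominated_path_op mh h_ge0 h_harmonic X_compact.
Let L_lin := path_op_lin mh h_ge0 h_harmonic X_compact.
Let L_sigma := path_op_sigma mh h_ge0 h_harmonic sigma_cont P_fiber
  X_compact X_hausdorff.

Lemma cylinder_continuous n (f : X -> R) : continuous f ->
  continuous (fun w : S => f (Z n w)).
Proof. by move=> cf; apply: cylinder_fun_continuous; exists n, f. Qed.

Lemma measurable_cylinder n (f : X -> R) : continuous f ->
  measurable_fun [set: borel S] (fun w : S => f (Z n w)).
Proof. by move=> cf; apply: continuous_borel; exact: cylinder_continuous. Qed.

Lemma measurable_Z n : measurable_fun [set: borel S] (Z n : borel S -> borel X).
Proof. by apply: continuous_borel_fun; exact: Z_continuous. Qed.

Lemma measurable_Z_preimage n (A : set (borel X)) : measurable A ->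
  measurable (Z n @^-1` A : set (borel S)).
Proof. by move=> mA; rewrite -[X in measurable X]setTI; exact: measurable_Z. Qed.

Lemma sol_measure_unique (mu nu : {measure set (borel S) -> \bar R}) :
  inner_regular mu -> inner_regular nu ->
  (mu setT < +oo)%E -> (nu setT < +oo)%E ->
  (forall n (f : X -> R), continuous f -> (forall x, 0 <= f x) ->
    (\int[mu]_w (f (Z n w))%:E = \int[nu]_w (f (Z n w))%:E)%E) ->
  forall E : set (borel S), measurable E -> mu E = nu E.
Proof.
move=> imu inu muoo nuoo munu.
apply: (inner_regular_unique S_hausdorff
  (cylinder_separating X_compact X_hausdorff sigma_cont R)) => //.
  exact: cylinder_fun_continuous.
move=> _ [n [f [cf ->]]] f0; apply: munu => // x.
by have [w <-] := @Z_surj _ sigma n x; exact: f0.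
Qed.

Section fibre_integral.
Variables (x : X) (Q : {measure set (borel S) -> \bar R}).

Let measurable_fiber : measurable (Z 0 @^-1` [set x] : set (borel S)).
Proof.
apply: measurable_Z_preimage; apply: closed_borel.
exact: compact_closed (@compact_set1 _ x).
Qed.

Lemma integral_fiber n (f : X -> R) : (Q setT < +oo)%E ->
  Q (~` (Z 0 @^-1` [set x])) = 0%E -> continuous f ->
  (\int[Q]_(w in Z 0 @^-1` [set x]) (f (Z n w))%:E = \int[Q]_w (f (Z n w))%:E)%E.
Proof.
move=> Qoo Q0 cf; rewrite [RHS](negligible_integral _ _ _ Q0)//.
- by rewrite setTD setCK.
- exact: measurableC.
- by apply: (continuous_integrable S_compact Qoo); exact: cylinder_continuous.
Qed.

Lemma path_measure_fiber : is_path_measure P h x Q ->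
  Q (~` (Z 0 @^-1` [set x])) = 0%E.
Proof.
move=> [_ QT Qprod].
have Qfiber : Q (Z 0 @^-1` [set x]) = (h x)%:E.
  have := Qprod 0%N (fun=> fun=> 1) (fun=> @cst_continuous X R 1).
  under eq_integral do rewrite big1//.
  rewrite integral_cst//. by rewrite mul1e /= mul1e.
have QTE : Q setT =
    (Q (Z 0 @^-1` [set x]) + Q (~` (Z 0 @^-1` [set x])))%E.
  by rewrite -measureU ?setUCr ?setICr//; exact: measurableC.
move: QTE; rewrite QT Qfiber.
case: (Q (~` _)) => [r| |]//; rewrite -EFinD => -[] /esym /(canRL (addKr _)).
by rewrite addNr => ->.
Qed.

Lemma integral_path_measure n (f : X -> R) : is_path_measure P h x Q ->
  continuous f -> (\int[Q]_w (f (Z n w))%:E = (L n f x)%:E)%E.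
Proof.
move=> Qpath cf; have Q0 := path_measure_fiber Qpath.
have [_ QT Qprod] := Qpath.
(* All factors but the last are 1, so the product formula isolates f o Z_n. *)
pose g i := if i == n then f else fun=> 1.
have cg i : continuous (g i).
  by rewrite /g; case: eqP => // _ y; exact: cvg_cst.
have gE (w : S) : path_prod sigma g n (Z n w) = f (Z n w).
  rewrite -path_prodE big_ord_recr/= /g eqxx big1 ?mul1r// => i _.
  by rewrite ltn_eqF.
have gf : path_prod sigma g n = f.
  by apply/funext => y; have [w <-] := @Z_surj _ sigma n y.
rewrite -integral_fiber ?QT ?ltry//.
under eq_integral do rewrite -gE -path_prodE.
by rewrite Qprod// (nested_op_path mh h_ge0 h_harmonic sigma_cont P_fiber)// gf.
Qed.

(** Together with [integral_path_measure], this characterizes path measures among regular measures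
    by their integrals of the functions f o Z_n, the form in which existence and uniqueness are
    proved. *)
Lemma path_measureP : inner_regular Q ->
  (forall n (f : X -> R), continuous f ->
    (\int[Q]_w (f (Z n w))%:E = (L n f x)%:E)%E) ->
  is_path_measure P h x Q.
Proof.
move=> iQ QL.
have QT : Q setT = (h x)%:E.
  have := QL 0%N (fun=> 1) (@cst_continuous X R 1).
  by rewrite integral_cst// mul1e path_op1.
have Q0 : Q (~` (Z 0 @^-1` [set x])) = 0%E.
  apply: (null_off_fiber (R := R) X_compact X_hausdorff S_hausdorff (@Z_continuous _ _ 0) iQ).
  by move=> g cg g0 gx; rewrite QL// /path_op/= gx mul0r.
split => // n f cf; rewrite (nested_op_path mh h_ge0 h_harmonic sigma_cont P_fiber)//.
under eq_integral do rewrite path_prodE.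
rewrite integral_fiber ?QT ?ltry// ?QL//; exact: path_prod_continuous.
Qed.

End fibre_integral.

Lemma path_measure_exists x :
  exists Q : {measure set (borel S) -> \bar R}, is_path_measure P h x Q.
Proof.
have [|||Q [iQ QL]] := @sol_measure_exists _ X_compact X_hausdorff _ sigma_cont R
    (fun n f => L n f x).
- by move=> n a f g cf cg; rewrite L_lin.
- by move=> n f _ f0; exact: path_op_ge0.
- by move=> n f cf; rewrite L_sigma.
- by exists Q; exact: path_measureP.
Qed.

Lemma path_measure_unique x (Q Q' : {measure set (borel S) -> \bar R}) :
  is_path_measure P h x Q -> is_path_measure P h x Q' ->
  forall E : set (borel S), measurable E -> Q E = Q' E.
Proof.
move=> pQ pQ'; have [iQ QT _] := pQ; have [iQ' QT' _] := pQ'.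
apply: sol_measure_unique => //; first by rewrite QT ltry.
  by rewrite QT' ltry.
by move=> n f cf _; rewrite (integral_path_measure n pQ cf) (integral_path_measure n pQ' cf).
Qed.

End path_measures.

(** * The mixture and its disintegration over Z_0 *)

Section mixture.
Context {R : realType} {X : ptopologicalType}.
Hypotheses (X_compact : compact [set: X]) (X_hausdorff : hausdorff_space X).
Variable sigma : {surj [set: X] >-> [set: X]}.
Hypothesis sigma_cont : continuous sigma.
Variables (P : R.-ker (borel X) ~> (borel X)) (h : borel X -> R).
Hypotheses (mh : measurable_fun [set: borel X] h) (h_ge0 : forall x, 0 <= h x).
Hypothesis h_harmonic : forall x, ext_op P (EFin \o h) x = (h x)%:E.
Hypothesis P_fiber : forall x, P x (~` (sigma @^-1` [set x])) = 0%E.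
Variable lam : {measure set (borel X) -> \bar R}.
Hypothesis lam_regular : inner_regular lam.
Hypothesis h_mass : (\int[lam]_x (h x)%:E = 1)%E.
Local Notation S := (sol sigma).
Local Notation L := (path_op P h).
Local Open Scope ereal_scope.

Let S_compact : compact [set: S] := sol_compact X_compact X_hausdorff sigma_cont.
Let S_hausdorff : hausdorff_space S := sol_hausdorff X_hausdorff (sigma := sigma).
Let dominated_L := dominated_path_op mh h_ge0 h_harmonic X_compact.
Let L_lin := path_op_lin mh h_ge0 h_harmonic X_compact.
Let L_sigma := path_op_sigma mh h_ge0 h_harmonic sigma_cont P_fiber
  X_compact X_hausdorff.
Let L_pull := path_op_pull mh h_ge0 h_harmonic sigma_cont P_fiber
  X_compact X_hausdorff.
Let S_unique := sol_measure_unique X_compact X_hausdorff sigma_cont (R := R).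

Let measurable_L n (f : X -> R) : continuous f -> measurable_fun setT (L n f).
Proof. by move=> cf; have [] := dominated_L n cf. Qed.

Let L_ge0 n (f : X -> R) : (forall x, (0 <= f x)%R) -> forall x, (0 <= L n f x)%R.
Proof. by move=> f0; exact: path_op_ge0. Qed.

Lemma path_op_integrable n (f : X -> R) : continuous f ->
  lam.-integrable setT (EFin \o L n f).
Proof.
by move=> cf; apply: (dominated_integrable mh h_ge0); [rewrite h_mass ltry|exact: dominated_L].
Qed.

Lemma mixture_exists : exists Pm : {measure set (borel S) -> \bar R},
  [/\ inner_regular Pm, Pm setT = 1
    & forall n (f : X -> R), continuous f ->
      \int[Pm]_w (f (Z n w))%:E = \int[lam]_x (L n f x)%:E].
Proof.
have fin n (f : X -> R) : continuous f -> \int[lam]_x (L n f x)%:E \is a fin_num.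
  by move=> cf; exact: (integrable_fin_num measurableT (path_op_integrable n cf)).
have [|||Pm [iPm PmL]] := @sol_measure_exists _ X_compact X_hausdorff _ sigma_cont R
    (fun n f => fine (\int[lam]_x (L n f x)%:E)).
- move=> n a f g cf cg; apply: EFin_inj.
  have caf : continuous (fun x => a * f x + g x)%R.
    by move=> x; apply: cvgD; [apply: cvgMr; exact: cf|exact: cg].
  rewrite fineK ?fin// L_lin// EFinD EFinM !fineK ?fin//.
  have iaf : lam.-integrable setT (EFin \o (fun x => a * L n f x)%R).
    exact: (integrableZl measurableT a (path_op_integrable n cf)).
  transitivity (\int[lam]_x (a * L n f x)%:E + \int[lam]_x (L n g x)%:E).
    by rewrite -integralD_EFin//; exact: path_op_integrable.
  congr (_ + _); under eq_integral do rewrite EFinM.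
  by rewrite integralZl//; exact: path_op_integrable.
- move=> n f cf f0; rewrite fine_ge0// integral_ge0// => x _.
  by rewrite lee_fin; exact: L_ge0.
- by move=> n f cf; rewrite L_sigma.
exists Pm; split => // [|n f cf]; last by rewrite PmL// fineK// fin.
have := PmL 0%N (fun=> 1%R) (@cst_continuous X R 1%R).
rewrite integral_cst// mul1e => ->; rewrite fineK; last exact/fin/cst_continuous.
by under eq_integral do rewrite path_op1.
Qed.

Variable Pm : {measure set (borel S) -> \bar R}.
Hypotheses (Pm_regular : inner_regular Pm) (Pm_mass : Pm setT = 1).
Hypothesis Pm_cylinder : forall n (f : X -> R), continuous f ->
  \int[Pm]_w (f (Z n w))%:E = \int[lam]_x (L n f x)%:E.

Let mZ n := @measurable_Z X sigma n.
Let mcyl n (f : X -> R) := @measurable_cylinder R X sigma n f.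

Let Pm_oo : Pm setT < +oo. Proof. by rewrite Pm_mass ltry. Qed.

(* Both measures are regular, so it suffices to compare them on continuous
   functions. *)
Lemma disintegration_cylinder n (f : X -> R) (g : X -> \bar R) :
  continuous f -> (forall x, (0 <= f x)%R) ->
  measurable_fun [set: borel X] g -> (forall x, 0 <= g x) ->
  \int[Pm]_w (g (Z 0 w) * (f (Z n w))%:E) = \int[lam]_x (g x * (L n f x)%:E).
Proof.
move=> cf f0 mg g0.
have mf := mcyl n cf; have f0' (w : S) : (0 <= f (Z n w))%R by exact: f0.
have mL := measurable_L n cf; have L0 := L_ge0 n f0.
pose m1 := image_measure (density_measure Pm mf f0') (mZ 0).
pose m2 := density_measure lam mL L0.
rewrite -(integral_density lam mL L0 mg g0).
rewrite -(integral_density Pm mf f0' (f := fun w => g (Z 0 w))); last 2 first.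
- exact: (measurableT_comp mg (mZ 0)).
- by move=> w; exact: g0.
rewrite -(integral_image_measure _ (mZ 0) mg g0).
apply: eq_measure_integral => A mA _.
have m2oo : m2 setT < +oo.
  rewrite /m2/= /density; have := path_op_integrable n cf => /integrableP[_].
  apply: le_lt_trans; under [leRHS]eq_integral do rewrite gee0_abs ?lee_fin//.
  exact: lexx.
have m12 : m1 setT = m2 setT.
  rewrite /m1 image_measureE preimage_setT /= /density.
  exact: Pm_cylinder.
apply: (inner_regular_unique X_hausdorff (separating_continuous R X_compact X_hausdorff)
  (mu := m1) (nu := m2)) => //.
- apply: inner_regular_image => //; first exact: Z_continuous.
  by apply: inner_regular_density => //; rewrite -[ltLHS]/(m1 setT) m12.
- exact: inner_regular_density.
- by rewrite m12.
move=> u cu u0.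
have mu : measurable_fun [set: borel X] (EFin \o u).
  by apply/measurable_EFinP; exact: continuous_borel.
rewrite integral_image_measure//.
rewrite (integral_density Pm mf f0' (f := fun w => (u (Z 0 w))%:E)); last 2 first.
- exact: (measurableT_comp mu (mZ 0)).
- by move=> w; rewrite lee_fin.
rewrite (integral_density lam mL L0 mu); last by move=> x; rewrite lee_fin.
have cun : continuous (fun y => u (iter n sigma y) * f y)%R.
  move=> y; apply: cvgM; last exact: cf.
  by apply: continuous_comp; [exact: iter_continuous|exact: cu].
(* u(Z_0) f(Z_n) is again a function of Z_n alone, namely ((u o sigma^n) f)(Z_n), and u comes out of
   R^n on the other side. *)
transitivity (\int[lam]_x (L n (fun y => u (iter n sigma y) * f y)%R x)%:E).
  rewrite -Pm_cylinder//; apply: eq_integral => w _.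
  by rewrite -EFinM -{1}(Z_iter 0 n w) add0n.
by apply: eq_integral => x _; rewrite L_pull// EFinM.
Qed.

Section disintegration.
Variable PP : borel X -> {measure set (borel S) -> \bar R}.
Hypothesis PP_path : forall x, is_path_measure P h x (PP x).

Let PP_cylinder x n (f : X -> R) (cf : continuous f) :
  \int[PP x]_w (f (Z n w))%:E = (L n f x)%:E :=
  integral_path_measure X_compact X_hausdorff sigma_cont mh h_ge0 h_harmonic
    P_fiber n (PP_path x) cf.

Let good (E : set S) : Prop :=
  [/\ measurable (E : set (borel S)), measurable_fun setT (PP ^~ E)
    & forall A : set (borel X), measurable A ->
        Pm (E `&` Z 0 @^-1` A) = \int[lam]_(x in A) PP x E].

(** The indicator of [E] is an increasing limit of cylinder functions. For these, measurability in x
    and the disintegration identity are known, and monotone convergence passes both to [E]. *)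
Lemma good_fsigma_open E : fsigma_open E -> good E.
Proof.
move=> fE; have mE : measurable (E : set (borel S)) by apply: open_borel; case: fE.
have [F [AF F0 ndF FE]] := fsigma_open_approx (R := R)
  (@cylinder_vector_lattice _ _ sigma_cont R)
  (cylinder_separating X_compact X_hausdorff sigma_cont R) fE.
have /choice[nf nfP] k : exists nf : nat * (X -> R),
    continuous nf.2 /\ F k = nf.2 \o Z nf.1.
  by have [n [f [cf ->]]] := AF k; exists (n, f).
have cf k : continuous (nf k).2 by case: (nfP k).
have f0 k x : (0 <= (nf k).2 x)%R.
  have [w <-] := @Z_surj _ sigma (nf k).1 x.
  by have := F0 k w; have [_ ->] := nfP k.
have mF k : measurable_fun [set: borel S] (fun w => (F k w)%:E).
  by apply/measurable_EFinP; have [_ ->] := nfP k; exact: mcyl.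
have F0E k w : 0 <= (F k w)%:E by rewrite lee_fin.
have ndFE w : nondecreasing_seq (fun k => (F k w)%:E).
  by move=> i j ij; rewrite lee_fin; exact: ndF.
(* A general base set serves both uses: the whole space for [PP x], and the preimage of [A] for
   [Pm]. *)
have limF (m : {measure set (borel S) -> \bar R}) (B : set (borel S)) :
    measurable B ->
    \int[m]_(w in B) (F k w)%:E @[k --> \oo] --> m (E `&` B).
  move=> mB; rewrite -integral_indic//.
  rewrite -[X in _ --> X](_ : \int[m]_(w in B) limn (fun k => (F k w)%:E) = _).
    by apply: cvg_monotone_convergence => // k; exact: measurable_funTS.
  by apply: eq_integral => w _; apply/cvg_lim => //; exact: FE.
have PPF x k : \int[PP x]_w (F k w)%:E = (L (nf k).1 (nf k).2 x)%:E.
  by have [_ ->] := nfP k; exact: PP_cylinder.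
have cvgL x : (L (nf k).1 (nf k).2 x)%:E @[k --> \oo] --> PP x E.
  have := limF (PP x) _ measurableT; rewrite setIT.
  by under eq_fun do rewrite PPF.
have mLE k : measurable_fun [set: borel X] (fun x => (L (nf k).1 (nf k).2 x)%:E).
  by apply/measurable_EFinP; exact: measurable_L.
split => //.
  by apply: (emeasurable_fun_cvg _ _ mLE) => x _; exact: cvgL.
move=> A mA; have mZA := measurable_Z_preimage (sigma := sigma) 0 mA.
have h1 := limF Pm _ mZA.
have eqk k : \int[Pm]_(w in Z 0 @^-1` A) (F k w)%:E =
    \int[lam]_(x in A) (L (nf k).1 (nf k).2 x)%:E.
  rewrite integral_mkcond [RHS]integral_mkcond.
  have mA1 : measurable_fun [set: borel X] (fun x => (\1_A x : R)%:E).
    by apply/measurable_EFinP; exact: measurable_indic.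
  have := disintegration_cylinder (nf k).1 (cf k) (f0 k) mA1
    (fun x => ltac:(rewrite lee_fin//)).
  have [_ Fk] := nfP k.
  move=> e; transitivity (\int[Pm]_w ((\1_A (Z 0 w) : R)%:E * ((nf k).2 (Z (nf k).1 w))%:E)).
    apply: eq_integral => w _; rewrite /patch indicE Fk.
    have -> : (w \in Z 0 @^-1` A) = (Z 0 w \in A) by apply/idP/idP; rewrite !inE.
    by case: ifPn => _; rewrite ?mul1e ?mul0e.
  rewrite e; apply: eq_integral => x _; rewrite /patch indicE.
  by case: ifPn => _; rewrite ?mul1e ?mul0e.
have h2 : \int[lam]_(x in A) (L (nf k).1 (nf k).2 x)%:E @[k --> \oo] -->
    \int[lam]_(x in A) PP x E.
  rewrite -[X in _ --> X](_ : \int[lam]_(x in A)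
      limn (fun k => (L (nf k).1 (nf k).2 x)%:E) = _).
    apply: cvg_monotone_convergence => // [k|k x _|x _ i j ij].
    - exact: measurable_funTS.
    - by rewrite lee_fin; exact: L_ge0.
    - rewrite -!PPF; apply: ge0_le_integral => // w _.
      exact: ndFE.
  by apply: eq_integral => x _; exact/cvg_lim.
rewrite -(cvg_lim _ h1)// -(cvg_lim _ h2)//.
by congr (limn _); apply/funext => k; exact: eqk.
Qed.

(** The open F_sigma sets are stable under intersection, so closure under complements and disjoint
    unions suffices. Complements rely on the finite masses h(x) of [PP x] and 1 of [Pm]. *)
Lemma good_sigma E : <<s fsigma_open >> E -> good E.
Proof.
rewrite -(setI_closed_g_dynkin_g_sigma_algebra (@fsigma_open_setI S)).
suff : <<d fsigma_open >> `<=` good by apply.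
have [mT _ PmT] := good_fsigma_open fsigma_openT.
apply: smallest_sub; last by move=> F; exact: good_fsigma_open.
split.
- exact: good_fsigma_open fsigma_openT.
- move=> F [mF mPF PmF].
  have PPC x : PP x (~` F) = (h x)%:E - PP x F.
    have [_ <- _] := PP_path x; rewrite -(setUv F) measureU//; last 2 first.
    + exact: measurableC.
    + exact: setICr.
    rewrite addeAC subee ?add0e//; have [_ PPT _] := PP_path x.
    rewrite ge0_fin_numE// (@le_lt_trans _ _ (PP x setT))//; last by rewrite PPT ltry.
    by apply: le_measure; rewrite ?inE.
  have mPC : measurable_fun setT (PP ^~ (~` F)).
    rewrite (_ : PP ^~ (~` F) = fun x => (h x)%:E - PP x F); last exact/funext.
    by apply: emeasurable_funB => //; exact/measurable_EFinP.
  split=> // [|A mA]; first exact: measurableC.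
  have mZA := measurable_Z_preimage (sigma := sigma) 0 mA.
  have FA_fin : Pm (F `&` Z 0 @^-1` A) \is a fin_num.
    rewrite ge0_fin_numE// (le_lt_trans _ Pm_oo)//.
    by apply: le_measure; rewrite ?inE//; exact: measurableI.
  have CA : Pm (~` F `&` Z 0 @^-1` A) + Pm (F `&` Z 0 @^-1` A) = Pm (Z 0 @^-1` A).
    rewrite (measureDI Pm mZA mF) setDE ![_ `&` Z 0 @^-1` A]setIC.
    by [].
  (* The integrals of the two pieces are added, which keeps the integrands nonnegative; the finite
     term for [F] is cancelled only afterwards. *)
  have IA : \int[lam]_(x in A) PP x (~` F) + \int[lam]_(x in A) PP x F =
      \int[lam]_(x in A) PP x setT.
    rewrite -ge0_integralD//; [|exact: measurable_funTS|exact: measurable_funTS].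
    apply: eq_integral => x _; rewrite -measureU ?setvU//; first exact: measurableC.
    exact: setICl.
  have TA := PmT _ mA; rewrite setTI in TA.
  have := congr1 (fun z => z - Pm (F `&` Z 0 @^-1` A)) CA.
  by rewrite TA -IA -(PmF _ mA) !addeK.
- move=> F tF gF.
  have mF k : measurable (F k : set (borel S)) by case: (gF k).
  have PPU x : PP x (\bigcup_k F k) = \sum_(k <oo) PP x (F k).
    by apply: measure_semi_bigcup => //; exact: bigcupT_measurable.
  have mPP k : measurable_fun setT (PP ^~ (F k)) by case: (gF k).
  split=> [||A mA]; first exact: bigcupT_measurable.
    rewrite (_ : PP ^~ _ = fun x => \sum_(k <oo) PP x (F k)); last exact/funext.
    by apply: ge0_emeasurable_sum.
  have mZA := measurable_Z_preimage (sigma := sigma) 0 mA.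
  under eq_integral do rewrite PPU.
  rewrite integral_nneseries//; last by move=> k; exact: measurable_funTS.
  rewrite setI_bigcupl measure_semi_bigcup//.
  + by apply: eq_eseriesr => k _; have [_ _] := gF k; exact.
  + by move=> k; exact: measurableI.
  + exact: trivIset_setIr.
  + by apply: bigcupT_measurable => k; exact: measurableI.
Qed.

Lemma mixture_is_disintegration : is_disintegration lam PP Pm.
Proof.
by move=> E A bE mA; have [_ _] := good_sigma (baire_fsigma_open bE); exact.
Qed.

Lemma mixture_is_mixture : is_mixture lam PP Pm.
Proof.
split => // E bE; have [_ mE PmE] := good_sigma (baire_fsigma_open bE).
by split => //; rewrite -[E in LHS]setIT; exact: PmE _ measurableT.
Qed.

(** Conditioning integrates over the law of Z_0, which is h lam, whereas the disintegration
    integrates over lam; the factor 1/h(x) compensates and makes the conditional measures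
    probabilities where h(x) > 0. *)
Lemma mixture_is_conditional :
  is_conditional_measure Pm (fun x E => (h x)^-1%:E * PP x E).
Proof.
move=> E bE; have [mE mPE PmE] := good_sigma (baire_fsigma_open bE).
have mhV : measurable_fun [set: borel X] (fun x => (h x)^-1)%R.
  under eq_fun do rewrite -powR_inv1//.
  exact: (measurableT_comp (measurable_powR _) mh).
have mc : measurable_fun [set: borel X] (fun x => (h x)^-1%:E * PP x E).
  by apply: emeasurable_funM => //; exact/measurable_EFinP.
split => // A mA; rewrite PmE//.
have mg : measurable_fun [set: borel X] (fun x => (\1_A x : R)%:E * ((h x)^-1%:E * PP x E)).
  apply: emeasurable_funM => //; apply/measurable_EFinP; exact: measurable_indic.
have g0 x : 0 <= (\1_A x : R)%:E * ((h x)^-1%:E * PP x E).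
  by rewrite !mule_ge0// lee_fin ?invr_ge0.
(* For n = 0 and f = 1 the weight on the side of [lam] is h, which identifies the law of Z_0. *)
have := disintegration_cylinder 0 (@cst_continuous X R 1%R) (fun _ => ler01) mg g0.
rewrite [X in X = _](_ : _ =
    \int[Pm]_(w in Z 0 @^-1` A) ((h (Z 0 w))^-1%:E * PP (Z 0 w) E)); last first.
  rewrite [RHS]integral_mkcond; apply: eq_integral => w _.
  rewrite mule1 /patch indicE.
  have -> : (w \in Z 0 @^-1` A) = (Z 0 w \in A) by apply/idP/idP; rewrite !inE.
  by case: ifPn => _; rewrite ?mul1e ?mul0e.
move=> ->; rewrite [LHS]integral_mkcond; apply: eq_integral => x _.
rewrite /patch indicE path_op1; case: ifPn => _; last by rewrite !mul0e.
rewrite mul1e muleAC -EFinM.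
(* Where h(x) = 0 the measure [PP x] has mass 0, so both sides vanish. *)
have [hx|hx] := eqVneq (h x) 0%R; last by rewrite mulVf// mul1e.
rewrite hx mulr0 mul0e; apply/eqP; rewrite eq_le measure_ge0 andbT.
have [_ PPT _] := PP_path x.
apply: (@le_trans _ _ (PP x setT)); last by rewrite PPT hx.
by apply: le_measure; rewrite ?inE.
Qed.

End disintegration.

(** * The Radon-Nikodym derivative of the shifted mixture *)

Variable W : borel X -> R.
Hypothesis W_RN : is_RN_derivative (act_measure P lam) lam W.

(** The hypothesis on [W] speaks of indicators; linearity and monotone convergence, applied under
    both integrals, extend it to nonnegative functions such as R^n(f h). *)
Lemma integral_kernel_RN (F : borel X -> \bar R) :
  measurable_fun setT F -> (forall x, 0 <= F x) ->
  \int[lam]_x (\int[P x]_y F y) = \int[lam]_x (F x * (W x)%:E).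
Proof.
have [mW W0 WE] := W_RN.
have mk (k : borel X -> \bar R) : measurable_fun setT k -> (forall x, 0 <= k x) ->
    measurable_fun setT (fun x => \int[P x]_y k y).
  move=> k1 k0; apply: measurable_fun_integral_kernel => // U mU.
  exact: measurable_kernel.
have mWE : measurable_fun setT (fun x => (W x)%:E) by exact/measurable_EFinP.
have W0E x : 0 <= (W x)%:E by rewrite lee_fin.
apply: (ge0_measurable_ind (Phi := fun F => _ = _)) => [A mA|a {}F G a0 mF F0 mG G0 IHF IHG|{}F G mF F0 ndF FG IH].
- rewrite -[LHS]/(act_measure P lam A) WE// integral_mkcond.
  apply: eq_integral => x _; rewrite /patch indicE.
  by case: ifPn => _; rewrite ?mul1e ?mul0e.
- have aE0 : 0 <= a%:E by rewrite lee_fin.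
  have mM k : measurable_fun setT k -> measurable_fun setT (fun x => k x * (W x)%:E).
    by move=> ?; exact: emeasurable_funM.
  transitivity (\int[lam]_x (a%:E * (\int[P x]_y F y) + \int[P x]_y G y)).
    apply: eq_integral => x _; rewrite ge0_integralD//; last 2 first.
    + by move=> y _; rewrite mule_ge0.
    + exact: emeasurable_funM.
    by rewrite ge0_integralZl_EFin.
  rewrite ge0_integralD//; last 4 first.
  + by move=> x _; rewrite mule_ge0// integral_ge0.
  + by apply: emeasurable_funM => //; exact: mk.
  + by move=> x _; rewrite integral_ge0.
  + exact: mk.
  rewrite ge0_integralZl_EFin//; last 2 first.
  + by move=> x _; rewrite integral_ge0.
  + exact: mk.
  rewrite IHF IHG -ge0_integralZl_EFin//; last 2 first.
  + by move=> x _; rewrite mule_ge0.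
  + exact: mM.
  rewrite -ge0_integralD//; last 4 first.
  + by move=> x _; rewrite !mule_ge0.
  + by apply: emeasurable_funM => //; exact: mM.
  + by move=> x _; rewrite mule_ge0.
  + exact: mM.
  apply: eq_integral => x _; rewrite ge0_muleDl ?mule_ge0//.
  by rewrite muleA.
- transitivity (\int[lam]_x limn (fun n => \int[P x]_y F n y)).
    apply: eq_integral => x _; rewrite -monotone_convergence//.
      by apply: eq_integral => y _; exact/esym/cvg_lim.
  rewrite monotone_convergence//; last 3 first.
  + by move=> n; exact: mk.
  + by move=> n x _; rewrite integral_ge0.
  + by move=> x _ m n mn; apply: ge0_le_integral => // y _; exact: ndF.
  under eq_fun do rewrite IH.
  rewrite -monotone_convergence//; last 3 first.
  + by move=> n; exact: emeasurable_funM.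
  + by move=> n x _; rewrite mule_ge0.
  + by move=> x _ m n mn; rewrite lee_wpmul2r// ndF.
  apply: eq_integral => x _; apply/cvg_lim => //.
  exact: cvgeZr.
Qed.

Definition sol_unshift (w : S) : S :=
  mk_sol (fun n => Z_sigma n.+1 w : sigma (Z n.+2 w) = Z n.+1 w).

Lemma sol_shiftK : cancel (@sol_shift X sigma) sol_unshift.
Proof. by move=> w; apply: sol_ext. Qed.

Lemma sol_unshiftK : cancel sol_unshift (@sol_shift X sigma).
Proof. by move=> w; apply: sol_ext => -[|n] //; rewrite Z_shift0; exact: Z_sigma. Qed.

(** For [U] open around u(w), a cylinder function F that is 1 at u(w) and 0 off [U] gives the
    neighbourhood of w where F o u > 0. This set is open since F depends on a single coordinate. *)
Lemma sol_continuousP (u : S -> S) :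
  (forall n, continuous (Z n \o u)) -> continuous u.
Proof.
move=> cu; apply/continuousP => U oU; rewrite openE => w Uw.
have cw : closed [set u w] := compact_closed S_hausdorff (@compact_set1 _ (u w)).
have [|F [[n [f [cf FE]]] _ F1 F0]] :=
    cylinder_separating X_compact X_hausdorff sigma_cont R cw oU.
  by move=> _ ->.
have cFu : continuous (f \o (Z n \o u)).
  by move=> v; apply: continuous_comp; [exact: cu|exact: cf].
have oV : open ((f \o (Z n \o u)) @^-1` [set r | (0 < r)%R]).
  by apply: open_comp => [v _|]; [exact: cFu|exact: open_gt].
apply: filterS (open_nbhs_nbhs (conj oV _)) => [v /= fv|].
  apply: contrapT => /F0; rewrite FE /= => fv0.
  by rewrite fv0 ltxx in fv.
by have := F1 _ erefl; rewrite FE /= => ->.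
Qed.

Lemma sol_shift_continuous : continuous (@sol_shift X sigma).
Proof.
apply: sol_continuousP => -[|n] w; last exact: (@Z_continuous _ _ n).
by apply: (@continuous_comp _ _ _ (Z 0) sigma); [exact: Z_continuous|exact: sigma_cont].
Qed.

Lemma sol_unshift_continuous : continuous sol_unshift.
Proof. by apply: sol_continuousP => n w; exact: (@Z_continuous _ _ n.+1). Qed.

Lemma measurable_shift :
  measurable_fun setT (@sol_shift X sigma : borel S -> borel S).
Proof. by apply: continuous_borel_fun; exact: sol_shift_continuous. Qed.

Lemma measurable_unshift :
  measurable_fun setT (sol_unshift : borel S -> borel S).
Proof. by apply: continuous_borel_fun; exact: sol_unshift_continuous. Qed.

(** On f o Z_n the unshifted image of [Pm] gives the integral of f o Z_(n+1), that is, of R(R^n(f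
    h)) against lam. One use of W turns this into the integral of W R^n(f h), which by
    disintegration is the integral of (W o Z_0)(f o Z_n) against [Pm]. Uniqueness of regular
    measures does the rest. *)
Lemma shift_RN (E : set (borel S)) : measurable E ->
  Pm (sol_unshift @^-1` E) = \int[Pm]_(w in E) (W (Z 0 w))%:E.
Proof.
have [mW W0 _] := W_RN.
have mWZ : measurable_fun [set: borel S] (fun w : S => W (Z 0 w)).
  exact: (measurableT_comp mW (mZ 0)).
have WZ0 (w : S) : (0 <= W (Z 0 w))%R by exact: W0.
pose m1 := image_measure Pm measurable_unshift.
pose m2 := density_measure Pm mWZ WZ0.
have m12 n (f : X -> R) : continuous f -> (forall x, (0 <= f x)%R) ->
    \int[m1]_w (f (Z n w))%:E = \int[m2]_w (f (Z n w))%:E.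
  move=> cf f0; have mf := mcyl n cf.
  have mfE : measurable_fun [set: borel S] (fun w : S => (f (Z n w))%:E).
    exact/measurable_EFinP.
  have f0E (w : S) : 0 <= (f (Z n w))%:E by rewrite lee_fin.
  rewrite integral_image_measure// (integral_density _ _ _ mfE f0E).
  transitivity (\int[lam]_x (L n.+1 f x)%:E).
    by rewrite -Pm_cylinder.
  transitivity (\int[lam]_x ((W x)%:E * (L n f x)%:E)); last first.
    rewrite -(disintegration_cylinder n cf f0); last 2 first.
    - exact/measurable_EFinP.
    - by move=> x; rewrite lee_fin.
    by apply: eq_integral => w _; rewrite muleC.
  transitivity (\int[lam]_x \int[P x]_y (L n f y)%:E).
    apply: eq_integral => x _; rewrite (kernel_opE mh h_ge0 h_harmonic)//.
    exact: dominated_L.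
  rewrite integral_kernel_RN//; last 2 first.
  - by apply/measurable_EFinP; exact: measurable_L.
  - by move=> x; rewrite lee_fin; exact: L_ge0.
  by apply: eq_integral => x _; rewrite muleC.
have m12T : m1 setT = m2 setT.
  have := m12 0%N (fun=> 1%R) (@cst_continuous X R 1%R) (fun=> ler01).
  by rewrite !integral_cst// !mul1e.
have m1oo : m1 setT < +oo by rewrite /m1 image_measureE preimage_setT.
move=> mE; apply: (S_unique (mu := m1) (nu := m2)) => //.
- by apply: inner_regular_image => //; exact: sol_unshift_continuous.
- by apply: inner_regular_density => //; rewrite -[ltLHS]/(m2 setT) -m12T.
- by rewrite -m12T.
Qed.

Lemma shifted_measureE (E : set (borel S)) :
  shifted_measure Pm E = Pm (sol_unshift @^-1` E).
Proof.
congr (Pm _); apply/seteqP; split=> [_ [w Ew <-]|w Ew].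
  by rewrite /preimage/= sol_shiftK.
by exists (sol_unshift w) => //; exact: sol_unshiftK.
Qed.

Lemma shifted_measure_RN :
  is_RN_derivative (shifted_measure Pm) Pm (fun w => W (Z 0 w)).
Proof.
have [mW W0 _] := W_RN; split=> [|w|E mE]; last by rewrite shifted_measureE shift_RN.
- exact: (measurableT_comp mW (mZ 0)).
- exact: W0.
Qed.

End mixture.

Section probability_of_measure.
Context d (T : measurableType d) (R : realType).
Variable mu : {measure set T -> \bar R}.
Hypothesis mu1 : (mu setT = 1)%E.

(* [mu1] has to occur in the body for the instances below to depend on it. *)
Definition probability_fun : set T -> \bar R := let _ := mu1 in mu.

HB.instance Definition _ := isMeasure.Build _ T R probability_fun
  (measure0 mu) (measure_ge0 mu) (@measure_semi_sigma_additive _ _ _ mu).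
HB.instance Definition _ :=
  Measure_isProbability.Build _ T R probability_fun mu1.

Definition probability_of_measure : probability T R := probability_fun.

End probability_of_measure.

Unset Implicit Arguments.
Set Strict Implicit.

Theorem theorem5p2 (R : realType) (X : ptopologicalType)
    (X_compact : compact [set: X]) (X_hausdorff : hausdorff_space X)
    (sigma : {surj [set: X] >-> [set: X]}) (sigma_cont : continuous sigma)
    (op : (X -> R) -> (borel X -> R))
    (op_transfer : is_transfer_operator sigma op)
    (P : R.-ker (borel X) ~> (borel X)) (P_riesz : is_riesz_kernel op P)
    (lam : {measure set (borel X) -> \bar R}) (lam_LR : in_LR P op lam)
    (W : borel X -> R) (W_RN : is_RN_derivative (act_measure P lam) lam W)
    (h : borel X -> R) (h_Linfty : h \in Lfun lam +oo%E)
    (h_ge0 : forall x, 0 <= h x)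
    (h_harmonic : forall x, ext_op P (EFin \o h) x = (h x)%:E)
    (h_mass : (\int[lam]_x (h x)%:E = 1)%E) :
  (forall x : X, exists Q : {measure set (borel (sol sigma)) -> \bar R},
      is_path_measure P h x Q /\
      forall Q' : {measure set (borel (sol sigma)) -> \bar R},
        is_path_measure P h x Q' ->
        forall E : set (borel (sol sigma)), measurable E -> Q' E = Q E)
  /\
  (forall PP : borel X -> {measure set (borel (sol sigma)) -> \bar R},
    (forall x, is_path_measure P h x (PP x)) ->
    exists Pm : probability (borel (sol sigma)) R,
      [/\ is_mixture lam PP Pm,
          is_disintegration lam PP Pm,
          is_conditional_measure Pm (fun x E => ((h x)^-1%:E * PP x E)%E),
          is_RN_derivative (shifted_measure Pm) Pm
            (fun w => W (Z 0 w))
        & is_L2_isometry Pm (weighted_shift W) /\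
          (is_L2_unitary Pm (weighted_shift W) <->
           (\forall w \ae Pm, 0 < W (Z 0 w)))]).
Proof.
have [iP _] := P_riesz; have [ilam _ _] := lam_LR.
have mh : measurable_fun [set: borel X] h.
  by move: h_Linfty; rewrite inE => /andP[]; rewrite inE.
have P_fiber := kernel_fiber X_compact X_hausdorff sigma_cont op_transfer P_riesz.
split=> [x|PP PP_path].
  have [Q pQ] := path_measure_exists X_compact X_hausdorff sigma_cont mh h_ge0
    h_harmonic P_fiber x.
  exists Q; split => // Q' pQ'.
  exact: (path_measure_unique X_compact X_hausdorff sigma_cont mh h_ge0 h_harmonic
    P_fiber pQ' pQ).
have [Pm0 [iPm0 Pm0T Pm0L]] := mixture_exists X_compact X_hausdorff sigma_cont mh
  h_ge0 h_harmonic P_fiber h_mass.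
pose Pm := probability_of_measure Pm0T.
have iPm : inner_regular Pm by exact: iPm0.
have PmT : (Pm setT = 1)%E by exact: Pm0T.
have PmL n (f : X -> R) : continuous f ->
    (\int[Pm]_w (f (Z n w))%:E = \int[lam]_x (path_op P h n f x)%:E)%E.
  exact: Pm0L.
have RN : is_RN_derivative (shifted_measure Pm) Pm (fun w => W (Z 0 w)).
  exact: (shifted_measure_RN X_compact X_hausdorff sigma_cont mh h_ge0 h_harmonic
    P_fiber ilam h_mass iPm PmT PmL W_RN).
have [mWZ WZ0 _] := RN.
have PmW (A : set (borel (sol sigma))) : measurable A -> Pm (@sol_unshift X sigma @^-1` A) =
    (\int[Pm]_(w in A) (W (Z 0 w))%:E)%E.
  exact: (shift_RN X_compact X_hausdorff sigma_cont mh h_ge0 h_harmonic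
    P_fiber ilam h_mass iPm PmT PmL W_RN).
have PmToo : (Pm setT < +oo)%E by rewrite PmT ltry.
have mshift := @measurable_shift R X X_compact X_hausdorff sigma sigma_cont.
have munshift := @measurable_unshift R X X_compact X_hausdorff sigma sigma_cont.
exists Pm; split => //.
- exact: (mixture_is_mixture X_compact X_hausdorff sigma_cont mh h_ge0 h_harmonic
    P_fiber ilam h_mass iPm PmT PmL PP_path).
- exact: (mixture_is_disintegration X_compact X_hausdorff sigma_cont mh h_ge0
    h_harmonic P_fiber ilam h_mass iPm PmT PmL PP_path).
- exact: (mixture_is_conditional X_compact X_hausdorff sigma_cont mh h_ge0
    h_harmonic P_fiber ilam h_mass iPm PmT PmL PP_path).
(* Weighted composition is instantiated with [s] the shift, [t] its inverse and weight W o Z_0. *)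
split.
- exact: (weighted_isometry mWZ WZ0 mshift munshift (@sol_unshiftK _ sigma) PmW).
- exact: (weighted_unitaryP PmToo mWZ WZ0 mshift munshift (@sol_shiftK _ sigma)
    (@sol_unshiftK _ sigma) PmW).
Qed.
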